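(* Let $\kappa>0$, $h>0$, $B=B(x_0,h)\subset\mathbb{R}^2$, let $q\ge1$ and $M\ge0$ be integers, and let $Z_q=(z_1,\ldots,z_q)\in\mathbb{C}^q$ with $|\operatorname{Im}z_j|\le\eta_{\max}<\infty$ for all $j$. Let $u$ be a Helmholtz field on $B$ with Fourier--Bessel expansion $u=\sum_{m\in\mathbb{Z}}a_m\varphi_m$ and finite trace norm, and set $\gamma_m=i^{-m}a_m$. Then $$\inf_{v\in\mathcal{V}_{q,M}(Z_q)}\|u-v\|_{\mathrm{tr}}^2=\min_{c\in\mathbb{C}^q}\ \sum_{|m|>M}\tau_m^2\,\Big|\gamma_m-\sum_{j=1}^q c_j e^{-imz_j}\Big|^2,$$ where $\mathcal{V}_{q,M}(Z_q)=\operatorname{span}\{\psi_{z_j}:1\le j\le q\}+\operatorname{span}\{\varphi_m:|m|\le M\}$. Repeated angles among the $z_j$ are allowed; they only make the plane-wave coefficient vector $c$ nonunique.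
   Context: With $(\rho,\psi)$ polar coordinates centred at $x_0$, $\varphi_m(\rho,\psi)=J_m(\kappa\rho)e^{im\psi}$, $m\in\mathbb{Z}$, where $J_m$ is the Bessel function of the first kind. For a complex angle $z\in\mathbb{C}$, $\psi_z(x)=e^{i\kappa d(z)\cdot(x-x_0)}$ with $d(z)=(\cos z,\sin z)\in\mathbb{C}^2$ and $d\cdot x=d_1x_1+d_2x_2$ (bilinear). The scaled Cauchy trace inner product is $$\langle v,w\rangle_{\mathrm{tr}}=\int_{\partial B}\big(\kappa\, v\,\overline{w}+\kappa^{-1}\,\partial_n v\,\overline{\partial_n w}\big)\,ds,\qquad \|v\|_{\mathrm{tr}}^2=\langle v,v\rangle_{\mathrm{tr}},$$ with $\partial_n$ the outward normal derivative on $\partial B$. The weights are $\tau_m>0$ with $\tau_m^2=2\pi h\kappa\big(J_m(\kappa h)^2+J_m'(\kappa h)^2\big)$. A Helmholtz field on $B$ solves $\Delta u+\kappa^2u=0$ in $B$; its Cauchy data on $\partial B$ are understood as the $L^2(\partial B)$ sums of the series of Cauchy data of $a_m\varphi_m$, and ''finite trace norm'' means $\sum_m|a_m|^2\tau_m^2<\infty$. *)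

(* Defs.v *)
From HB Require Import structures.
From mathcomp Require Import all_boot all_order all_algebra.
From mathcomp Require Import complex.
From mathcomp Require Import all_classical all_reals all_analysis.
Import Order.TTheory GRing.Theory Num.Theory.
Import numFieldNormedType.Exports Normc.

Set Implicit Arguments.
Unset Strict Implicit.
Unset Printing Implicit Defensive.

Local Open Scope classical_set_scope.
Local Open Scope ring_scope.

(* R[i] is used as a plain field: limits, derivatives and measurability of
   complex-valued functions are expressed through complex.Re, complex.Im and
   the real-valued modulus normc. *)

Definition plane (R : realType) : normedModType R := (R * R)%type.

Definition cexp (R : realType) (z : R[i]) : R[i] :=
  (expR (complex.Re z))%:C%C * (cos (complex.Im z) +i* sin (complex.Im z))%C.

Definition ccos (R : realType) (z : R[i]) : R[i] :=
  (cexp ('i%C * z) + cexp (- ('i%C * z))) / 2%:R.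

Definition csin (R : realType) (z : R[i]) : R[i] :=
  (cexp ('i%C * z) - cexp (- ('i%C * z))) / (2%:R * 'i%C).

Definition besselJ_nat (R : realType) (n : nat) (x : R) : R :=
  limn (series (fun k : nat =>
    (-1) ^+ k / (k`! * (k + n)`!)%:R * (x / 2) ^+ (k.*2 + n))).

Definition besselJ (R : realType) (m : int) (x : R) : R :=
  match m with
  | Posz n => besselJ_nat n x
  | Negz n => (-1) ^+ n.+1 * besselJ_nat n.+1 x
  end.

Definition enorm (R : realType) (x : plane R) : R :=
  Num.sqrt (x.1 ^+ 2 + x.2 ^+ 2).

Definition disc (R : realType) (x0 : plane R) (h : R) : set (plane R) :=
  [set x | enorm (x - x0) < h].

(* e^(i m psi) is written as (w / |w|)^m with w = x - x0 seen as a complex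
   number.  At x = x0, where w / |w| = 0, this gives J_0(0) for m = 0 and 0
   for m != 0, as it should; see fourier_bessel_polar below. *)
Definition fourier_bessel (R : realType) (kappa : R) (x0 : plane R) (m : int)
    (x : plane R) : R[i] :=
  let w := x - x0 in
  (besselJ m (kappa * enorm w))%:C%C *
    ((w.1 +i* w.2)%C / (enorm w)%:C%C) ^ m.

Definition plane_wave (R : realType) (kappa : R) (x0 : plane R) (z : R[i])
    (x : plane R) : R[i] :=
  let w := x - x0 in
  cexp ('i%C * kappa%:C%C * (ccos z * (w.1)%:C%C + csin z * (w.2)%:C%C)).

Definition cderive (R : realType) (f : plane R -> R[i]) (v x : plane R) : R[i] :=
  ('D_v (fun y => complex.Re (f y) : R) x +i*
   'D_v (fun y => complex.Im (f y) : R) x)%C.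

Definition c2_on (R : realType) (B : set (plane R)) (f : plane R -> R) : Prop :=
  forall x, B x -> differentiable f x /\
    forall v : plane R, differentiable ('D_v f) x /\
      forall w : plane R, {for x, continuous ('D_w ('D_v f))}.

Definition laplacian (R : realType) (f : plane R -> R[i]) (x : plane R) : R[i] :=
  let e1 : plane R := (1, 0) in
  let e2 : plane R := (0, 1) in
  cderive (cderive f e1) e1 x + cderive (cderive f e2) e2 x.

Definition helmholtz_field (R : realType) (kappa : R) (B : set (plane R))
    (u : plane R -> R[i]) : Prop :=
  [/\ c2_on B (fun x => complex.Re (u x)),
      c2_on B (fun x => complex.Im (u x)) &
      forall x, B x -> laplacian u x + (kappa ^+ 2)%:C%C * u x = 0].

(* sum of F m over the integers m with |m| <= N *)
Definition symsum (R : realType) (N : nat) (F : int -> R[i]) : R[i] :=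
  \sum_(k < (N.*2).+1) F (k%:Z - N%:Z).

Definition fourier_bessel_expansion (R : realType) (kappa : R) (x0 : plane R)
    (B : set (plane R)) (u : plane R -> R[i]) (a : int -> R[i]) : Prop :=
  forall x, B x ->
    (fun N : nat =>
       normc (u x - symsum N (fun m => a m * fourier_bessel kappa x0 m x)))
      @ \oo --> (0 : R).

Definition tau (R : realType) (kappa h : R) (m : int) : R :=
  Num.sqrt (2 * pi * h * kappa *
    (besselJ m (kappa * h) ^+ 2 + derive1 (besselJ m) (kappa * h) ^+ 2)).

Definition finite_trace_norm (R : realType) (kappa h : R) (a : int -> R[i]) :
    Prop :=
  (\esum_(m in [set: int]) (normc (a m) ^+ 2 * tau kappa h m ^+ 2)%:E < +oo)%E.

Definition circle_pt (R : realType) (x0 : plane R) (h t : R) : plane R :=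
  (x0.1 + h * cos t, x0.2 + h * sin t).

(* arc-length integral of F over the circle of centre x0 and radius h *)
Definition circle_int (R : realType) (x0 : plane R) (h : R) (F : plane R -> R) :
    \bar R :=
  (h%:E * \int[@lebesgue_measure R]_(t in `[0%R, (2 * pi)%R]%classic)
            (F (circle_pt x0 h t))%:E)%E.

Definition circle_measurable (R : realType) (x0 : plane R) (h : R)
    (f : plane R -> R[i]) : Prop :=
  measurable_fun `[0%R, (2 * pi)%R]%classic
    (fun t : R => complex.Re (f (circle_pt x0 h t))) /\
  measurable_fun `[0%R, (2 * pi)%R]%classic
    (fun t : R => complex.Im (f (circle_pt x0 h t))).

(* only meaningful for x on the circle, where (x - x0) / h is the outward unit
   normal *)
Definition normal_derive (R : realType) (x0 : plane R) (h : R)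
    (f : plane R -> R[i]) (x : plane R) : R[i] :=
  cderive f (h^-1 *: (x - x0)) x.

(* ||.||_tr^2 of the Cauchy data (f, g), i.e. the value of the trace inner
   product of (f, g) with itself *)
Definition trace_norm2 (R : realType) (kappa : R) (x0 : plane R) (h : R)
    (f g : plane R -> R[i]) : \bar R :=
  circle_int x0 h
    (fun x => kappa * normc (f x) ^+ 2 + kappa^-1 * normc (g x) ^+ 2).

Definition circle_L2_sum (R : realType) (x0 : plane R) (h : R)
    (F : int -> plane R -> R[i]) (f : plane R -> R[i]) : Prop :=
  circle_measurable x0 h f /\
  (fun N : nat =>
     circle_int x0 h (fun x => normc (f x - symsum N (fun m => F m x)) ^+ 2))
    @ \oo --> (0 : \bar R)%E.

(* (f, g) represents the Cauchy data of sum_m a_m phi_m; only the values of f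
   and g on the circle matter *)
Definition cauchy_data (R : realType) (kappa : R) (x0 : plane R) (h : R)
    (a : int -> R[i]) (f g : plane R -> R[i]) : Prop :=
  circle_L2_sum x0 h (fun m x => a m * fourier_bessel kappa x0 m x) f /\
  circle_L2_sum x0 h
    (fun m x => a m * normal_derive x0 h (fourier_bessel kappa x0 m) x) g.

Definition trial_space (R : realType) (kappa : R) (x0 : plane R) (q M : nat)
    (z : 'I_q -> R[i]) : set (plane R -> R[i]) :=
  [set v | exists (c : 'I_q -> R[i]) (b : int -> R[i]),
    v = fun x => \sum_(j < q) c j * plane_wave kappa x0 (z j) x +
                 symsum M (fun m => b m * fourier_bessel kappa x0 m x)].

Definition weighted_residual (R : realType) (kappa h : R) (q M : nat)
    (z : 'I_q -> R[i]) (gamma : int -> R[i]) (c : 'I_q -> R[i]) : \bar R :=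
  (\esum_(m in [set m : int | (M < `|m|)%N])
     (tau kappa h m ^+ 2 *
      normc (gamma m - \sum_(j < q) c j * cexp (- ('i%C * m%:~R * z j))) ^+ 2)%:E)%E.

Lemma fourier_bessel_polar (R : realType) (kappa : R) (x0 : plane R) (m : int)
    (rho t : R) : 0 < rho ->
  fourier_bessel kappa x0 m (circle_pt x0 rho t) =
  (besselJ m (kappa * rho))%:C%C * (cos t +i* sin t)%C ^ m.
Proof.
move=> rho0; rewrite /fourier_bessel.
have -> : circle_pt x0 rho t - x0 = (rho * cos t, rho * sin t) :> plane R.
  by rewrite /circle_pt; case: x0 => a b; congr pair => /=; rewrite addrC addKr.
have -> : enorm ((rho * cos t, rho * sin t) : plane R) = rho.
  rewrite /enorm /= [(rho * cos t) ^+ 2]exprMn [(rho * sin t) ^+ 2]exprMn.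
  by rewrite -mulrDr cos2Dsin2 mulr1 sqrtr_sqr gtr0_norm.
have r0 : rho%:C%C != 0 :> R[i] by rewrite eq_complex /= negb_and gt_eqF.
have E : (rho * cos t +i* (rho * sin t))%C / rho%:C%C = (cos t +i* sin t)%C.
  apply: (mulIf r0); rewrite divfK //.
  by apply/eqP; rewrite eq_complex /= !mulr0 subr0 add0r ![_ * rho]mulrC !eqxx.
by rewrite -E.
Qed.

(* Main.v *)
Require Import Defs.
From mathcomp Require Import all_boot all_order all_algebra.
From mathcomp Require Import complex ring zify.
From mathcomp Require Import all_classical all_reals all_analysis measurable_realfun.
Import Order.TTheory GRing.Theory Num.Theory.
Import numFieldNormedType.Exports Normc.

Set Implicit Arguments.
Unset Strict Implicit.
Unset Printing Implicit Defensive.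

Local Open Scope classical_set_scope.
Local Open Scope ring_scope.


(** Everything happens in coefficient space. On the circle of radius h the Cauchy data
of the mode of order m are J_m(kappa h) e^(imt) and kappa J_m'(kappa h) e^(imt).
Different modes are orthogonal there and the squared trace norm of one mode is
tau_m^2, so a field with coefficients d_m has squared trace norm
sum_m tau_m^2 |d_m|^2 ([trace_norm2_parseval]).

A plane wave with complex angle z has the coefficients i^m e^(-imz), by the
Jacobi-Anger expansion, which has to hold in L^2 of the circle for the values as
well as for the normal derivatives ([cauchy_series_plane_wave]). With
zeta = e^(i(t-z)), both follow from the uniform convergence of
S_N(x) = sum_(|m| <= N) i^m J_m(x) zeta^m to exp(alpha x), where
alpha = i (zeta + 1/zeta) / 2. The recurrence 2 J_m' = J_(m-1) - J_(m+1) turns the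
sum of the derivatives into alpha S_N plus four boundary terms, which are
controlled by the factorial decay of J_m in m; hence S_N exp(- alpha x) has a
small derivative and equals 1 at x = 0 ([jacobi_anger],
[jacobi_anger_derive]). All bounds depend on zeta only through
|zeta| = e^(Im z), which is constant on the circle.

For a trial field with plane wave coefficients c and Fourier-Bessel coefficients
b, the squared trace error is therefore a sum over all m whose terms with
|m| > M do not contain b and form the weighted residual of c
([weighted_residual_le]), while the terms with |m| <= M are annihilated by a
suitable b ([weighted_residual_attained]). The infimum over (c, b) is thus the
infimum over c of the weighted residual, a nonnegative quadratic function of
finitely many real variables, and such a function attains its minimum even when
it is degenerate, as it is for repeated angles ([quadratic_min],
[residual_min]). *)


(** * Complex numbers and the complex exponential *)

Section ComplexNumbers.
Variable R : realType.
Implicit Types (x y w : R[i]) (r s t : R).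

Lemma complex_ReD x y : complex.Re (x + y) = complex.Re x + complex.Re y.
Proof. by case: x; case: y. Qed.

Lemma complex_ImD x y : complex.Im (x + y) = complex.Im x + complex.Im y.
Proof. by case: x; case: y. Qed.

Lemma complex_ReN x : complex.Re (- x) = - complex.Re x.
Proof. by case: x. Qed.

Lemma complex_ImN x : complex.Im (- x) = - complex.Im x.
Proof. by case: x. Qed.

Lemma complex_ReM x y : complex.Re (x * y) =
  complex.Re x * complex.Re y - complex.Im x * complex.Im y.
Proof. by case: x; case: y. Qed.

Lemma complex_ImM x y : complex.Im (x * y) =
  complex.Re x * complex.Im y + complex.Im x * complex.Re y.
Proof. by case: x => a b; case: y. Qed.

Lemma complex_eqP x y :
  complex.Re x = complex.Re y -> complex.Im x = complex.Im y -> x = y.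
Proof. by case: x; case: y => a b c d /= -> ->. Qed.

Definition complexpE := (complex_ReD, complex_ImD, complex_ReN, complex_ImN,
  complex_ReM, complex_ImM).

Lemma normc2E x : normc x ^+ 2 = complex.Re x ^+ 2 + complex.Im x ^+ 2.
Proof. by case: x => a b /=; rewrite sqr_sqrtr// addr_ge0 ?sqr_ge0. Qed.

Lemma normc_ge0 x : 0 <= normc x.
Proof. by case: x => a b; exact: sqrtr_ge0. Qed.

Lemma normcD x y : normc (x + y) <= normc x + normc y.
Proof.
have := Num.Theory.ler_normD x y.
by rewrite -[`|x + y|]/((normc _)%:C%C) -[`|x|]/((normc _)%:C%C)
  -[`|y|]/((normc _)%:C%C) -rmorphD/= lecR.
Qed.

Lemma normcN x : normc (- x) = normc x.
Proof. by case: x => a b /=; rewrite !sqrrN. Qed.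

Lemma normcX x n : normc (x ^+ n) = normc x ^+ n.
Proof.
by elim: n => [|n IH]; rewrite ?expr0 ?normc1// !exprS normcM IH.
Qed.

Lemma normc_real r : normc r%:C%C = `|r|.
Proof. by rewrite /= expr0n/= addr0 sqrtr_sqr. Qed.

Lemma normc_i : normc ('i%C : R[i]) = 1.
Proof. by rewrite /= expr0n/= add0r expr1n sqrtr1. Qed.

Lemma normc_ReIm x : normc x <= `|complex.Re x| + `|complex.Im x|.
Proof.
rewrite -[leRHS]ger0_norm ?addr_ge0// -ler_sqr ?nnegrE ?normc_ge0 ?normr_ge0//.
rewrite normc2E real_normK ?num_real// sqrrD !real_normK ?num_real//.
by rewrite addrAC lerDl mulrn_wge0 ?mulr_ge0.
Qed.

Lemma normr_Re x : `|complex.Re x| <= normc x.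
Proof.
by rewrite -ler_sqr ?nnegrE ?normc_ge0// normc2E real_normK ?num_real// lerDl
  sqr_ge0.
Qed.

Lemma normr_Im x : `|complex.Im x| <= normc x.
Proof.
by rewrite -ler_sqr ?nnegrE ?normc_ge0// normc2E real_normK ?num_real// lerDr
  sqr_ge0.
Qed.

(** Young's inequality takes the place of the triangle inequality of L^2, because it
can be integrated without taking square roots. *)
Lemma normc2D_le (e : R) x y : 0 < e ->
  normc (x + y) ^+ 2 <= (1 + e) * normc x ^+ 2 + (1 + e^-1) * normc y ^+ 2.
Proof.
move=> e0; rewrite !normc2E !complexpE.
have key (a b : R) : (a + b) ^+ 2 <= (1 + e) * a ^+ 2 + (1 + e^-1) * b ^+ 2.
  rewrite -subr_ge0 [leRHS](_ : _ = e * (a - e^-1 * b) ^+ 2); last first.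
    by field; rewrite gt_eqF.
  by rewrite mulr_ge0 ?sqr_ge0 ?ltW.
have := lerD (key (complex.Re x) (complex.Re y)) (key (complex.Im x) (complex.Im y)).
by move/le_trans; apply; rewrite le_eqVlt; apply/orP; left; apply/eqP; ring.
Qed.

Lemma complex_sqr_i : ('i%C : R[i]) * 'i%C = -1.
Proof. by rewrite -expr2 sqr_i. Qed.

Lemma complex_i_neq0 : ('i%C : R[i]) != 0.
Proof. by rewrite eq_complex /= oner_eq0 andbF. Qed.

Lemma complex_i_unit : ('i%C : R[i]) \is a GRing.unit.
Proof. by rewrite unitfE complex_i_neq0. Qed.

Lemma complex_invi : ('i%C : R[i])^-1 = - 'i%C.
Proof.
by apply: (mulfI complex_i_neq0); rewrite mulfV ?complex_i_neq0// mulrN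
  complex_sqr_i opprK.
Qed.

Lemma normc_exprz x (m : int) : normc (x ^ m) = normc x ^ m.
Proof.
by case: m => n; rewrite ?NegzE -?exprnP -?exprnN ?normcV ?normcX.
Qed.

Lemma cexp0 : cexp (0 : R[i]) = 1.
Proof. by rewrite /cexp /= expR0 cos0 sin0 mul1r. Qed.

Lemma cexpD x y : cexp (x + y) = cexp x * cexp y.
Proof.
rewrite /cexp !complexpE expRD sinD cosD.
by apply: complex_eqP; rewrite !complexpE /=; ring.
Qed.

Lemma normc_cexp x : normc (cexp x) = expR (complex.Re x).
Proof.
rewrite /cexp normcM normc_real ger0_norm ?expR_ge0//= cos2Dsin2 sqrtr1.
by rewrite mulr1.
Qed.

Lemma cexp_neq0 x : cexp x != 0.
Proof.
apply/eqP => x0; have := normc_cexp x; rewrite x0 normc0 => /esym/eqP.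
by rewrite gt_eqF ?expR_gt0.
Qed.

Lemma cexpN x : cexp (- x) = (cexp x)^-1.
Proof.
apply: (mulIf (cexp_neq0 x)).
by rewrite -cexpD addNr cexp0 mulVf ?cexp_neq0.
Qed.

Lemma cexp_mulz x (m : int) : cexp (m%:~R * x) = cexp x ^ m.
Proof.
have natE n : cexp (n%:R * x) = cexp x ^+ n.
  elim: n => [|n IH]; first by rewrite mul0r cexp0.
  by rewrite -addn1 natrD mulrDl mul1r cexpD IH addn1 exprSr.
case: m => n; first by rewrite -exprnP -natE.
by rewrite NegzE mulrNz mulNr cexpN -exprnN -natE.
Qed.

Lemma cis_cexp t : (cos t +i* sin t)%C = cexp ('i%C * t%:C%C).
Proof.
by rewrite /cexp !complexpE /= !mul0r !mulr0 subr0 add0r mul1r expR0 mul1r.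
Qed.

Lemma cexp_mulz_period (m : int) : cexp ('i%C * m%:~R * (2 * pi)%:C%C) = 1 :> R[i].
Proof.
rewrite -mulrA mulrCA cexp_mulz -cis_cexp mulr_natl cos2pi sin2pi.
by rewrite exp1rz.
Qed.

End ComplexNumbers.

(** * Derivatives of complex-valued functions of a real variable *)

Section ComplexDerivative.
Variable R : realType.
Implicit Types (f g : R -> R[i]) (x : R) (d e : R[i]).

Definition is_cderive x f d :=
  is_derive x 1 (fun s => complex.Re (f s)) (complex.Re d) /\
  is_derive x 1 (fun s => complex.Im (f s)) (complex.Im d).

Lemma is_cderive_eq x f d e : is_cderive x f d -> d = e -> is_cderive x f e.
Proof. by move=> + <-. Qed.

Lemma is_cderive_cst x d : is_cderive x (fun=> d) 0.
Proof. by split; exact: is_derive_cst. Qed.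

Lemma is_cderiveD x f g d e : is_cderive x f d -> is_cderive x g e ->
  is_cderive x (fun s => f s + g s) (d + e).
Proof.
move=> [fr fi] [gr gi]; split; rewrite complexpE.
- by under eq_fun do rewrite complexpE; exact: is_deriveD.
- by under eq_fun do rewrite complexpE; exact: is_deriveD.
Qed.

Lemma is_cderiveM x f g d e : is_cderive x f d -> is_cderive x g e ->
  is_cderive x (fun s => f s * g s) (d * g x + f x * e).
Proof.
move=> [fr fi] [gr gi]; split; rewrite !complexpE.
- under eq_fun do rewrite complexpE.
  by apply: is_derive_eq; rewrite /GRing.scale/=; ring.
- under eq_fun do rewrite complexpE.
  by apply: is_derive_eq; rewrite /GRing.scale/=; ring.
Qed.

Lemma is_cderiveZ x f d e : is_cderive x f d ->
  is_cderive x (fun s => e * f s) (e * d).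
Proof.
move=> df; apply: is_cderive_eq (is_cderiveM (is_cderive_cst x e) df) _.
by rewrite mul0r add0r.
Qed.

Lemma is_cderive_sum x (n : nat) (F : 'I_n -> R -> R[i]) (D : 'I_n -> R[i]) :
  (forall i, is_cderive x (F i) (D i)) ->
  is_cderive x (fun s => \sum_(i < n) F i s) (\sum_(i < n) D i).
Proof.
elim: n F D => [|n IH] F D dF.
  under eq_fun do rewrite big_ord0; rewrite big_ord0; exact: is_cderive_cst.
under eq_fun do rewrite big_ord_recr; rewrite big_ord_recr.
by apply: is_cderiveD (dF _); apply: IH.
Qed.

Lemma is_cderive_real x (f : R -> R) (d : R) : is_derive x 1 f d ->
  is_cderive x (fun s => (f s)%:C%C) d%:C%C.
Proof. by move=> df; split => //=; exact: is_derive_cst. Qed.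

Lemma is_cderive_cexp_comp x f d : is_cderive x f d ->
  is_cderive x (fun s => cexp (f s)) (d * cexp (f x)).
Proof.
move=> [fr fi].
have E (w : R[i]) : cexp w = (expR (complex.Re w) * cos (complex.Im w) +i*
    (expR (complex.Re w) * sin (complex.Im w)))%C.
  by apply: complex_eqP; rewrite /cexp !complexpE/= ?mul0r ?subr0 ?addr0.
have de := is_derive1_comp (is_derive_expR _) fr.
have ds := is_derive1_comp (is_derive_sin _) fi.
have dc := is_derive1_comp (is_derive_cos _) fi.
split; under eq_fun do rewrite E /=; rewrite complexpE E /=.
- by apply: (is_derive_eq (is_deriveM de dc)); rewrite /GRing.scale/=; ring.
- by apply: (is_derive_eq (is_deriveM de ds)); rewrite /GRing.scale/=; ring.
Qed.

Lemma is_cderive_cexp x (w : R[i]) :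
  is_cderive x (fun s => cexp (w * s%:C%C)) (w * cexp (w * x%:C%C)).
Proof.
have := is_cderiveZ w (is_cderive_real (is_derive_id x (1 : R))).
by move/is_cderive_cexp_comp => /=; rewrite rmorph1 mulr1.
Qed.

End ComplexDerivative.


(** * Bessel functions *)

Section BesselFunctions.
Variable R : realType.
Implicit Types (n k : nat) (x y : R) (m : int).

Definition bessel_coeff n k : R := (-1) ^+ k / (k`! * (k + n)`!)%:R.

(** The entire function L_n such that J_n(x) = (x/2)^n L_n((x/2)^2): a power series in y,
to which termwise differentiation applies. *)
Definition bessel_reduced n y := limn (pseries (bessel_coeff n) y).

Lemma normr_bessel_coeff n k : `|bessel_coeff n k| <= n`!%:R^-1 * k`!%:R^-1.
Proof.
rewrite /bessel_coeff normrM normrX normrN1 expr1n mul1r normfV normr_nat.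
rewrite -invfM -natrM lef_pV2 ?posrE ?ltr0n ?muln_gt0 ?fact_gt0//.
by rewrite ler_nat mulnC leq_mul// leq_fact// leq_addl.
Qed.

Lemma normr_bessel_term n k y :
  `|bessel_coeff n k * y ^+ k| <= n`!%:R^-1 * exp_coeff `|y| k.
Proof.
rewrite normrM normrX /exp_coeff /= mulrCA [leRHS]mulrC.
by rewrite ler_wpM2r ?exprn_ge0// normr_bessel_coeff.
Qed.

Lemma is_cvg_normed_bessel n y :
  cvgn [normed pseries (bessel_coeff n) y].
Proof.
apply: (@series_le_cvg _ _ (fun k => n`!%:R^-1 * exp_coeff `|y| k)).
- by move=> k /=; exact: normr_ge0.
- by move=> k; rewrite mulr_ge0 ?invr_ge0// exp_coeff_ge0.
- by move=> k; exact: normr_bessel_term.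
- exact/is_cvg_seriesZ/is_cvg_series_exp_coeff.
Qed.

Lemma is_cvg_bessel n y : cvgn (pseries (bessel_coeff n) y).
Proof. exact/normed_cvg/is_cvg_normed_bessel. Qed.

Lemma normr_bessel_reduced n y : `|bessel_reduced n y| <= n`!%:R^-1 * expR `|y|.
Proof.
apply: le_trans (lim_series_norm (is_cvg_normed_bessel (n := n) (y := y))) _.
have -> : n`!%:R^-1 * expR `|y| =
    limn (series (fun k => n`!%:R^-1 * exp_coeff `|y| k)).
  by rewrite lim_seriesZ//; exact: is_cvg_series_exp_coeff.
apply: lim_series_le.
- exact: is_cvg_normed_bessel.
- exact/is_cvg_seriesZ/is_cvg_series_exp_coeff.
- by move=> k; exact: normr_bessel_term.
Qed.

Lemma bessel_coeff_diffs n :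
  pseries_diffs (bessel_coeff n) = - bessel_coeff n.+1.
Proof.
apply/funext => k; rewrite /pseries_diffs /bessel_coeff opprfctE factS exprS.
rewrite addSnnS mulN1r mulNr mulrN; congr (- _).
rewrite -mulnA [X in _ / X]natrM invfM mulrCA.
by rewrite mulVKf// pnatr_eq0.
Qed.


Lemma is_derive_bessel_reduced n y :
  is_derive y (1 : R) (bessel_reduced n) (- bessel_reduced n.+1 y).
Proof.
have limN k z : limn (pseries (- bessel_coeff k) z) = - bessel_reduced k z.
  rewrite /bessel_reduced -lim_seriesN; last exact: is_cvg_bessel.
  by congr (limn (series _)); apply/funext => i /=; rewrite mulNr.
have cvgN k z : cvgn (pseries (- bessel_coeff k) z).
  rewrite /pseries (_ : (fun _ => _) = - (fun i => bessel_coeff k i * z ^+ i)).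
    by rewrite is_cvg_seriesN; exact: is_cvg_bessel.
  by apply/funext => i /=; rewrite mulNr.
rewrite -limN -bessel_coeff_diffs.
apply: (@pseries_snd_diffs _ _ (`|y| + 1)); rewrite ?pseries_diffsN
  ?bessel_coeff_diffs ?pseries_diffsN ?bessel_coeff_diffs ?opprK//.
- exact: is_cvg_bessel.
- exact: is_cvg_bessel.
- by rewrite [ltRHS]ger0_norm// ltrDl.
Qed.

(** Termwise the identity reads c_n(k) = (n + 1 + k) c_(n+1)(k), and the sum weighted
by k is a derivative. *)
Lemma bessel_reduced_rec n y :
  bessel_reduced n y = n.+1%:R * bessel_reduced n.+1 y - y * bessel_reduced n.+2 y.
Proof.
apply: cvg_lim => //.
have h1 : series (fun k => k%:R * bessel_coeff n.+1 k * y ^+ k.-1) @ \oo -->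
    - bessel_reduced n.+2 y.
  have := @pseries_diffs_equiv R (bessel_coeff n.+1) y.
  rewrite bessel_coeff_diffs /pseries.
  rewrite (_ : (fun i => (- bessel_coeff n.+2) i * _) =
    - (fun i => bessel_coeff n.+2 i * y ^+ i)); last first.
    by apply/funext => i /=; rewrite mulNr.
  rewrite is_cvg_seriesN lim_seriesN; last exact: is_cvg_bessel.
  by apply; exact: is_cvg_bessel.
have h2 := is_cvg_bessel (n := n.+1) (y := y).
have h3 := cvgD (cvgMl_tmp (a := n.+1%:R) h2) (cvgMl_tmp (a := y) h1).
rewrite -mulrN.
suff -> : pseries (bessel_coeff n) y =
    (fun K => n.+1%:R * pseries (bessel_coeff n.+1) y K +
      y * series (fun k => k%:R * bessel_coeff n.+1 k * y ^+ k.-1) K) by exact: h3.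
apply/funext => K.
rewrite /pseries /series /= !mulr_sumr -big_split/=; apply: eq_bigr => k _.
have -> : bessel_coeff n k = (n.+1%:R + k%:R) * bessel_coeff n.+1 k.
  rewrite /bessel_coeff -natrD addSn addnS factS mulnCA [X in _ = _ * (_ / X)]natrM (addnC n).
  by rewrite invfM mulrCA mulVKf// pnatr_eq0.
rewrite mulrDl mulrDl -mulrA; congr (_ + _).
case: k => [|k]; first by rewrite !mul0r mulr0.
by rewrite exprS; ring.
Qed.

Lemma besselJ_natE n x :
  besselJ_nat n x = (x / 2) ^+ n * bessel_reduced n ((x / 2) ^+ 2).
Proof.
rewrite /bessel_reduced -[RHS]/(_ *: _) -lim_seriesZ; last exact: is_cvg_bessel.
rewrite /besselJ_nat; congr (limn (series _)); apply/funext => k.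
by rewrite fctE /GRing.scale/= /bessel_coeff -exprM mul2n exprD mulrA mulrC.
Qed.

Lemma is_derive_bessel_reduced_sq n x :
  is_derive x (1 : R) (fun t => bessel_reduced n ((t / 2) ^+ 2))
    (- bessel_reduced n.+1 ((x / 2) ^+ 2) * (x / 2)).
Proof.
have d1 : is_derive x (1 : R) (fun t : R => (t / 2) ^+ 2) (x / 2).
  by apply: is_derive_eq; rewrite /GRing.scale/=; field.
exact: (@is_derive1_comp _ (bessel_reduced n) (fun t => (t / 2) ^+ 2) _ _ _
  (is_derive_bessel_reduced n ((x / 2) ^+ 2)) d1).
Qed.

Lemma is_derive_besselJ_nat0 x :
  is_derive x (1 : R) (besselJ_nat 0) (- besselJ_nat 1 x).
Proof.
rewrite (_ : besselJ_nat 0 = fun x => bessel_reduced 0 ((x / 2) ^+ 2)); last first.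
  by apply/funext => t; rewrite besselJ_natE expr0 mul1r.
apply: is_derive_eq (is_derive_bessel_reduced_sq 0 x) _.
by rewrite besselJ_natE expr1 mulNr mulrC.
Qed.

Lemma is_derive_besselJ_natS n x : is_derive x (1 : R) (besselJ_nat n.+1)
  ((besselJ_nat n x - besselJ_nat n.+2 x) / 2).
Proof.
rewrite (_ : besselJ_nat n.+1 =
  fun x => (x / 2) ^+ n.+1 * bessel_reduced n.+1 ((x / 2) ^+ 2)); last first.
  by apply/funext => t; rewrite besselJ_natE.
have d0 : is_derive x (1 : R) (fun t : R => t / 2) (2^-1).
  by apply: is_derive_eq; rewrite /GRing.scale/=; field.
have d1 := is_derive_bessel_reduced_sq n.+1 x.
have d2 := is_deriveX n.+1 d0; rewrite exprfctE in d2.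
have d3 := is_deriveM d2 d1; rewrite mulrfctE in d3.
apply: (is_derive_eq d3).
rewrite !besselJ_natE /GRing.scale/= (bessel_reduced_rec n) !exprS.
by field.
Qed.

(** The convention J_(-n) = (-1)^n J_n makes the same recurrence hold for all integer
orders. *)
Lemma is_derive_besselJ m x : is_derive x (1 : R) (besselJ m)
  ((besselJ (m - 1) x - besselJ (m + 1) x) / 2).
Proof.
case: m => [[|n]|n].
- apply: (is_derive_eq (is_derive_besselJ_nat0 x)).
  by rewrite /= expr1 mulN1r; field.
- rewrite -addn1 PoszD addrK -PoszD addn1 -PoszD addn1.
  exact: is_derive_besselJ_natS.
- have dJ := is_derive_besselJ_natS n x.
  apply: (is_derive_eq (is_deriveZ ((-1) ^+ n.+1) dJ)).
  have -> : Negz n - 1 = Negz n.+1 by rewrite !NegzE -opprD -PoszD addn1.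
  rewrite /GRing.scale; case: n {dJ} => [|n].
    by rewrite /= expr1 expr2; field.
  have -> : Negz n.+1 + 1 = Negz n.
    by rewrite !NegzE -[n.+2]addn1 PoszD opprD addrNK.
  by rewrite /= !exprS; field.
Qed.

(** The decay in m beats every geometric growth; this is what makes expansions with the
geometrically growing coefficients of a complex angle converge. *)
Lemma normr_besselJ m x : `|besselJ m x| <=
  exp_coeff (`|x| / 2) `|m|%N * expR ((x / 2) ^+ 2).
Proof.
have natP n : `|besselJ_nat n x| <= exp_coeff (`|x| / 2) n * expR ((x / 2) ^+ 2).
  rewrite besselJ_natE normrM normrX /exp_coeff/= -mulrA normf_div (ger0_norm (ler0n R 2)).
  rewrite ler_wpM2l ?exprn_ge0 ?divr_ge0//.
  by apply: le_trans (normr_bessel_reduced _ _) _; rewrite (ger0_norm (sqr_ge0 _)).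
by case: m => n //=; rewrite normrM normrX normrN1 expr1n mul1r.
Qed.

Lemma besselJ_at0 m : besselJ m (0 : R) = (m == 0)%:R.
Proof.
have natP n : besselJ_nat n (0 : R) = (n == 0)%:R.
  rewrite besselJ_natE mul0r expr0n; case: n => [|n]; last by rewrite mul0r.
  rewrite mul1r expr0n; apply: cvg_lim => //; rewrite -cvg_shiftS.
  apply: cvg_near_cst; near=> N; rewrite /pseries /series/= big_nat_recl//=.
  rewrite big1 => [|i _]; last by rewrite exprS mul0r mulr0.
  by rewrite addr0 expr0 mulr1 /bessel_coeff expr0 fact0 divr1.
by case: m => n //=; rewrite natP mulr0.
Unshelve. all: by end_near. Qed.

End BesselFunctions.

(** * Symmetric sums over the integers *)

Section SymmetricSums.
Variable V : zmodType.
Implicit Types (F G : int -> V) (N : nat).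

(** [symsum] for summands in any additive group, because both real and complex summands
occur. *)
Definition isum N F : V := \sum_(k < N.*2.+1) F (k%:Z - N%:Z).

Lemma isum0 F : isum 0 F = F 0.
Proof. by rewrite /isum big_ord_recl big_ord0 addr0. Qed.

Lemma isumS N F : isum N.+1 F = F (- N.+1%:Z) + isum N F + F N.+1%:Z.
Proof.
rewrite /isum doubleS big_ord_recl big_ord_recr /= sub0r -addrA.
congr (_ + (_ + _)).
- by apply: eq_bigr => k _; rewrite /bump/= add1n -addn1 -[N.+1]addn1 !PoszD
    opprD addrACA subrr addr0.
- by congr F; rewrite /bump/= add1n -addnn -addSn -addnS PoszD addrK.
Qed.

Lemma eq_isum N F G : (forall m, (`|m| <= N)%N -> F m = G m) -> isum N F = isum N G.
Proof.
elim: N => [|N IH] FG; first by rewrite !isum0 FG.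
rewrite !isumS !FG ?abszN// IH// => m mN; apply: FG; exact: leqW.
Qed.

Lemma isumD N F G : isum N (fun m => F m + G m) = isum N F + isum N G.
Proof. exact: big_split. Qed.

Lemma isumN N F : isum N (fun m => - F m) = - isum N F.
Proof. exact: sumrN. Qed.

Lemma isumB N F G : isum N (fun m => F m - G m) = isum N F - isum N G.
Proof. by rewrite isumD isumN. Qed.

Lemma isum_telescope N F : isum N (fun m => F (m + 1) - F m) =
  F (N%:Z + 1) - F (- N%:Z).
Proof.
elim: N => [|N IH]; first by rewrite isum0.
rewrite isumS IH -[N.+1]addn1 PoszD.
have -> : - (N%:Z + 1) + 1 = - N%:Z by rewrite opprD addrNK.
by rewrite [F (- N%:Z) - _ + _]addrC subrKA addrC subrKA.
Qed.

End SymmetricSums.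


Section SymmetricSumsComplex.
Variable R : realType.

Lemma isumZ N (c : R[i]) F : isum N (fun m => c * F m) = c * isum N F.
Proof. by rewrite /isum mulr_sumr. Qed.

Lemma is_cderive_isum (x : R) N (F : int -> R -> R[i]) (D : int -> R[i]) :
  (forall m, is_cderive x (F m) (D m)) ->
  is_cderive x (fun s => isum N (fun m => F m s)) (isum N D).
Proof. by move=> FD; apply: is_cderive_sum => k; exact: FD. Qed.

(** The factor 2 comes from applying the mean value theorem to each component. *)
Lemma is_cderive_mvt (f df : R -> R[i]) (x K : R) : 0 <= x ->
  (forall s, is_cderive s f (df s)) ->
  (forall s, 0 <= s <= x -> normc (df s) <= K) ->
  normc (f x - f 0) <= 2 * (K * x).
Proof.
move=> x0 fdf dfK.
have mvt (g dg : R -> R) : (forall s : R, is_derive s 1 g (dg s)) ->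
    (forall s, 0 <= s <= x -> `|dg s| <= K) -> `|g x - g 0| <= K * x.
  move=> gdg dgK.
  have [|c c0x ->] := MVT_segment x0 (fun s _ => gdg s).
    apply: continuous_subspaceT => s.
    exact/differentiable_continuous/derivable1_diffP.
  rewrite subr0 normrM (ger0_norm x0) ler_wpM2r//; apply: dgK.
  by rewrite in_itv/= in c0x.
apply: le_trans (normc_ReIm _) _; rewrite !complexpE mulr_natl mulr2n lerD//.
- apply: (mvt (fun s => complex.Re (f s)) (fun s => complex.Re (df s))) => [s|s sx]; first by case: (fdf s).
  exact: le_trans (normr_Re _) (dfK _ sx).
- apply: (mvt (fun s => complex.Im (f s)) (fun s => complex.Im (df s))) => [s|s sx]; first by case: (fdf s).
  exact: le_trans (normr_Im _) (dfK _ sx).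
Qed.

End SymmetricSumsComplex.

(** * The Jacobi-Anger expansion *)

Section JacobiAnger.
Variable R : realType.
Implicit Types (zeta : R[i]) (x r : R) (N : nat) (m : int).

(** For zeta = e^(i theta) this is i cos theta, and the generating function of the Bessel
functions is the exponential of x times this number. *)
Definition ja_exponent zeta : R[i] := 'i%C * (zeta + zeta^-1) / 2.

Definition ja_sum N zeta x : R[i] :=
  isum N (fun m => ('i%C * zeta) ^ m * (besselJ m x)%:C%C).

(** The derivative of [ja_sum] in x, written with the recurrence for J_m'. *)
Definition ja_dsum N zeta x : R[i] :=
  isum N (fun m => ('i%C * zeta) ^ m * ((besselJ (m - 1) x - besselJ (m + 1) x) / 2)%:C%C).

(** The boundary terms left over when the two index shifts of the recurrence are undone in
a truncated sum. *)
Definition ja_defect N zeta x : R[i] :=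
  (('i%C * zeta) ^ (- N%:Z) * (besselJ (- N%:Z - 1) x)%:C%C
  - ('i%C * zeta) ^ (N%:Z + 1) * (besselJ N x)%:C%C
  - ('i%C * zeta) ^ N * (besselJ (N%:Z + 1) x)%:C%C
  + ('i%C * zeta) ^ (- N%:Z - 1) * (besselJ (- N%:Z) x)%:C%C) / 2.

Lemma is_cderive_ja_sum N zeta x :
  is_cderive x (ja_sum N zeta) (ja_dsum N zeta x).
Proof.
apply: is_cderive_isum => m; apply: is_cderiveZ.
exact/is_cderive_real/is_derive_besselJ.
Qed.

(** With A_m = w^(m+1) J_m and B_m = w^(m-1) J_m for w = i zeta, twice the difference of the
two sides is the sum of A_(m-1) - A_m and B_m - B_(m+1), which telescopes. *)
Lemma ja_dsumE N zeta x : zeta != 0 ->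
  ja_dsum N zeta x = ja_exponent zeta * ja_sum N zeta x + ja_defect N zeta x.
Proof.
move=> z0; set w := 'i%C * zeta.
have w0 : w != 0 by rewrite mulf_neq0// complex_i_neq0.
have wu : w \is a GRing.unit by rewrite unitfE.
have wV : w^-1 = - 'i%C * zeta^-1 by rewrite invfM complex_invi.
(* The shifted index in A gives both telescoping sums the same form. *)
pose A m : R[i] := w ^ m * (besselJ (m - 1) x)%:C%C.
pose B m : R[i] := w ^ (m - 1) * (besselJ m x)%:C%C.
apply/eqP; rewrite addrC -subr_eq /ja_dsum /ja_sum -isumZ -isumB; apply/eqP.
transitivity (- (2^-1 * (isum N (fun m => A (m + 1) - A m) +
    isum N (fun m => B (m + 1) - B m)))).
  rewrite -isumD -isumZ -isumN; apply: eq_isum => m _.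
  rewrite /A /B !addrK exprzDr// expr1z exprzDr//.
  rewrite exprN1 wV /ja_exponent -/w rmorphM rmorphB fmorphV rmorph_nat/=.
  by rewrite /w; field.
rewrite (isum_telescope N A) (isum_telescope N B) /ja_defect /A /B addrK -/w.
by field.
Qed.

(** A bound for [ja_defect] on [0, x], valid when both |zeta| and 1/|zeta| are at most r; it
consists of terms of a convergent exponential series. *)
Definition ja_error r x N : R := expR ((x / 2) ^+ 2) *
  (r * exp_coeff (r * (x / 2)) N + exp_coeff (r * (x / 2)) N.+1).

Lemma cvg_ja_error r x : ja_error r x @ \oo --> (0 : R).
Proof.
have e0 := @cvg_exp_coeff R (r * (x / 2)).
have e1 : (fun N => exp_coeff (r * (x / 2)) N.+1) @ \oo --> (0 : R).
  by rewrite -[X in X @ _ --> _]/(fun N => (exp_coeff (r * (x / 2))) N.+1) cvg_shiftS.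
have := cvgMl_tmp (a := expR ((x / 2) ^+ 2)) (cvgD (cvgMl_tmp (a := r) e0) e1).
by rewrite mulr0 addr0 mulr0; apply.
Qed.

Section RadiusBound.
Variables (zeta : R[i]) (r : R).
Hypotheses (zeta0 : zeta != 0) (zeta_r : normc zeta <= r)
  (zetaV_r : (normc zeta)^-1 <= r).

Let nz_gt0 : 0 < normc zeta.
Proof.
rewrite lt_neqAle normc_ge0 andbT eq_sym.
by apply: contra_neq zeta0 => /eq0_normc.
Qed.

Let r_ge1 : 1 <= r.
Proof.
have [z1|/ltW z1] := leP 1 (normc zeta); first exact: le_trans z1 zeta_r.
by apply: le_trans zetaV_r; rewrite invf_ge1.
Qed.

Lemma normc_ja_power (m : int) n : (`|m| <= n)%N ->
  normc (('i%C * zeta) ^ m) <= r ^+ n.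
Proof.
move=> mn; rewrite normc_exprz normcM normc_i mul1r.
apply: le_trans (_ : r ^+ `|m|%N <= _); last by rewrite ler_weXn2l.
case: m {mn} => k; rewrite ?NegzE -?exprnP -?exprnN /= -?exprVn;
  rewrite lerXn2r ?nnegrE ?invr_ge0 ?normc_ge0// ?(le_trans ler01)//.
Qed.

Lemma normc_ja_term (m k : int) n N x y : (`|m| <= N.+1)%N -> `|k|%N = n ->
  `|x| <= y ->
  normc (('i%C * zeta) ^ m * (besselJ k x)%:C%C) <=
  r ^+ N.+1 * (exp_coeff (y / 2) n * expR ((y / 2) ^+ 2)).
Proof.
move=> mN kn xy; rewrite normcM normc_real ler_pM ?normc_ge0 ?normc_ja_power//.
apply: le_trans (normr_besselJ _ _) _; rewrite kn.
rewrite ler_pM ?expR_ge0 ?exp_coeff_ge0 ?divr_ge0//.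
- rewrite /exp_coeff/= ler_wpM2r ?invr_ge0// lerXn2r ?nnegrE ?divr_ge0//.
    exact: le_trans xy.
  by rewrite ler_wpM2r.
- rewrite ler_expR -[leLHS]real_normK ?num_real// lerXn2r ?nnegrE ?divr_ge0//.
    exact: le_trans xy.
  by rewrite normf_div (ger0_norm (ler0n R 2)) ler_wpM2r.
Qed.

Lemma normc_ja_defect N x y : `|x| <= y ->
  normc (ja_defect N zeta x) <= ja_error r y N.
Proof.
move=> xy; rewrite /ja_defect normcM.
have -> : normc (2 : R[i])^-1 = 2^-1.
  by rewrite normcV -[2 : R[i]](rmorph_nat (real_complex R)) normc_real ger0_norm.
pose J n := r ^+ N.+1 * (exp_coeff (y / 2) n * expR ((y / 2) ^+ 2)).
have -> : ja_error r y N = (J N.+1 + J N + J N.+1 + J N) / 2.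
  rewrite /ja_error /J /exp_coeff/= !exprMn !exprS; field.
  by rewrite !pnatr_eq0 -!lt0n !fact_gt0.
have tri (a b c d : R[i]) :
    normc (a - b - c + d) <= normc a + normc b + normc c + normc d.
  apply: le_trans (normcD _ _) _; rewrite lerD2r.
  apply: le_trans (normcD _ _) _; rewrite normcN lerD2r.
  by apply: le_trans (normcD _ _) _; rewrite normcN.
rewrite ler_wpM2r ?invr_ge0//; apply: le_trans (tri _ _ _ _) _.
by rewrite !lerD//; apply: normc_ja_term;
  rewrite // -?opprD ?abszN -?PoszD ?addn1 //= ?leqnSn.
Qed.

Lemma normc_ja_exponent : normc (ja_exponent zeta) <= r.
Proof.
rewrite /ja_exponent !normcM normc_i mul1r.
have -> : normc (2 : R[i])^-1 = 2^-1.
  by rewrite normcV -[2 : R[i]](rmorph_nat (real_complex R)) normc_real ger0_norm.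
rewrite ler_pdivrMr// mulr_natr mulr2n.
by apply: le_trans (normcD _ _) _; rewrite normcV lerD.
Qed.

Lemma normc_cexp_le (w : R[i]) (s x : R) : normc w <= r -> 0 <= s <= x ->
  normc (cexp (w * s%:C%C)) <= expR (r * x).
Proof.
move=> wr /andP[s0 sx]; rewrite normc_cexp ler_expR complexpE/= mulr0 subr0.
apply: le_trans (_ : normc w * s <= _).
  by rewrite ler_wpM2r// (le_trans (ler_norm _))// normr_Re.
by rewrite ler_pM ?normc_ge0.
Qed.

(** The truncated sum S satisfies S' = alpha S up to the small [ja_defect], so that
S exp(- alpha x) has a small derivative; it equals 1 at x = 0 because J_m(0) = 0 for
m <> 0. *)
Lemma jacobi_anger N x : 0 <= x ->
  normc (ja_sum N zeta x - cexp (ja_exponent zeta * x%:C%C)) <=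
  2 * expR (r * x) ^+ 2 * x * ja_error r x N.
Proof.
move=> x0; set al := ja_exponent zeta.
pose D s := ja_sum N zeta s * cexp (- al * s%:C%C).
pose dD s := ja_defect N zeta s * cexp (- al * s%:C%C).
have DD s : is_cderive s D (dD s).
  apply: is_cderive_eq (is_cderiveM (is_cderive_ja_sum N zeta s)
    (is_cderive_cexp s (- al))) _.
  by rewrite ja_dsumE// -/al /dD; ring.
have dDK s : 0 <= s <= x -> normc (dD s) <= ja_error r x N * expR (r * x).
  move=> /andP[s0 sx]; rewrite normcM ler_pM ?normc_ge0//.
    by apply: normc_ja_defect; rewrite ger0_norm.
  by apply: normc_cexp_le; rewrite ?normcN ?normc_ja_exponent ?s0.
have D0 : D 0 = 1.
  rewrite /D rmorph0 mulr0 cexp0 mulr1 /ja_sum.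
  elim: N {D dD DD dDK} => [|N IH]; first by rewrite isum0 besselJ_at0 expr0z mulr1.
  by rewrite isumS IH !besselJ_at0 oppr_eq0/= !mulr0 add0r addr0.
have := is_cderive_mvt x0 DD dDK; rewrite D0 => DK.
have -> : ja_sum N zeta x - cexp (al * x%:C%C) = (D x - 1) * cexp (al * x%:C%C).
  have cc : cexp (- al * x%:C%C) * cexp (al * x%:C%C) = 1.
    by rewrite -cexpD mulNr addNr cexp0.
  by rewrite mulrBl mul1r /D -(mulrA (ja_sum N zeta x)) cc mulr1.
rewrite normcM; apply: le_trans (_ : 2 * (ja_error r x N * expR (r * x) * x) *
  expR (r * x) <= _).
  rewrite ler_pM ?normc_ge0//; apply: normc_cexp_le; rewrite ?normc_ja_exponent//.
  by rewrite x0 lexx.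
by rewrite le_eqVlt; apply/orP; left; apply/eqP; ring.
Qed.

(** Follows from [jacobi_anger], since S' is alpha S up to the defect. *)
Lemma jacobi_anger_derive N x : 0 <= x ->
  normc (ja_dsum N zeta x -
    ja_exponent zeta * cexp (ja_exponent zeta * x%:C%C)) <=
  (2 * expR (r * x) ^+ 2 * x * r + 1) * ja_error r x N.
Proof.
move=> x0; rewrite ja_dsumE// addrAC -mulrBr.
apply: le_trans (normcD _ _) _; rewrite mulrDl mul1r lerD//; last first.
  by apply: normc_ja_defect; rewrite ger0_norm.
rewrite normcM [leLHS]mulrC [leRHS]mulrAC ler_pM ?normc_ge0 ?normc_ja_exponent//.
exact: jacobi_anger.
Qed.

End RadiusBound.

End JacobiAnger.


(** * Modes and plane waves on the circle *)

Section RadialDerivatives.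
Variables (R : realType) (x0 : plane R) (h : R).
Hypothesis h_gt0 : 0 < h.

(** The unit normal of the circle is the radial direction, so a normal derivative is an
ordinary derivative in the radius. *)
Lemma normal_derive_radial (f : plane R -> R[i]) (t : R) (d : R[i]) :
  is_cderive h (fun rho => f (circle_pt x0 rho t)) d ->
  normal_derive x0 h f (circle_pt x0 h t) = d.
Proof.
pose v : plane R := (cos t, sin t).
have vE : h^-1 *: (circle_pt x0 h t - x0) = v.
  rewrite /circle_pt /v; case: x0 => a b /=; congr pair => /=;
  by rewrite addrAC subrr add0r /GRing.scale/= mulKf ?gt_eqF.
have ptE s : s *: v + circle_pt x0 h t = circle_pt x0 (s *: 1 + h) t.
  rewrite /circle_pt /v; case: x0 => a b /=; congr pair => /=;
  rewrite /GRing.scale/=; ring.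
have dirE (g : plane R -> R) : 'D_v g (circle_pt x0 h t) =
    'D_1 (fun rho : R => g (circle_pt x0 rho t)) h.
  rewrite /derive; set q1 := (fun _ => _); set q2 := (X in _ = lim (X @ _)).
  by have -> : q1 = q2 by apply/funext => s; rewrite /q1 /= ptE.
move=> [dr di]; rewrite /normal_derive vE /cderive !dirE.
by rewrite !derive_val; case: d {dr di}.
Qed.

End RadialDerivatives.

Section CircleTraces.
Variables (R : realType) (kappa h : R) (x0 : plane R).
Hypotheses (kappa_gt0 : 0 < kappa) (h_gt0 : 0 < h).

Definition cis (t : R) : R[i] := (cos t +i* sin t)%C.

Lemma cisV (t : R) : (cis t)^-1 = (cos t -i* sin t)%C.
Proof.
by rewrite [cis t]cis_cexp -cexpN -mulrN -rmorphN -cis_cexp cosN sinN.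
Qed.

Lemma derive1_besselJ m (x : R) :
  derive1 (besselJ m) x = (besselJ (m - 1) x - besselJ (m + 1) x) / 2.
Proof. by rewrite derive1E; have dJ := is_derive_besselJ m x; rewrite derive_val. Qed.

Lemma is_cderive_fourier_bessel m t : is_cderive h
  (fun rho => fourier_bessel kappa x0 m (circle_pt x0 rho t))
  ((kappa * derive1 (besselJ m) (kappa * h))%:C%C * cis t ^ m).
Proof.
pose g rho : R[i] := (besselJ m (kappa * rho))%:C%C * cis t ^ m.
have dg : is_cderive h g ((kappa * derive1 (besselJ m) (kappa * h))%:C%C * cis t ^ m).
  rewrite mulrC /g; under eq_fun do rewrite mulrC.
  apply: is_cderiveZ; apply: is_cderive_real.
  rewrite derive1_besselJ [kappa * (_ / _)]mulrC.
  have d1 : is_derive h (1 : R) (fun rho : R => kappa * rho) kappa.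
    by apply: is_derive_eq; rewrite /GRing.scale/=; ring.
  exact: (@is_derive1_comp _ (besselJ m) (fun rho => kappa * rho) _ _ _
    (is_derive_besselJ m (kappa * h)) d1).
(* The polar form of the mode holds for positive radii only. *)
have gE : \forall rho \near h, g rho =
    fourier_bessel kappa x0 m (circle_pt x0 rho t).
  near=> rho; rewrite fourier_bessel_polar//.
  by near: rho; exact: lt_nbhsr.
case: dg => dr di; split.
- have gRe : \forall rho \near h, complex.Re (g rho) =
      complex.Re (fourier_bessel kappa x0 m (circle_pt x0 rho t)).
    by apply: filterS gE => rho ->.
  apply: (near_eq_is_derive _ dr); exact: gRe.
- have gIm : \forall rho \near h, complex.Im (g rho) =
      complex.Im (fourier_bessel kappa x0 m (circle_pt x0 rho t)).
    by apply: filterS gE => rho ->.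
  apply: (near_eq_is_derive _ di); exact: gIm.
Unshelve. all: by end_near. Qed.

Lemma fourier_bessel_circle m t :
  fourier_bessel kappa x0 m (circle_pt x0 h t) =
  (besselJ m (kappa * h))%:C%C * cis t ^ m.
Proof. exact: fourier_bessel_polar. Qed.

Lemma normal_derive_fourier_bessel m t :
  normal_derive x0 h (fourier_bessel kappa x0 m) (circle_pt x0 h t) =
  (kappa * derive1 (besselJ m) (kappa * h))%:C%C * cis t ^ m.
Proof. exact/normal_derive_radial/is_cderive_fourier_bessel. Qed.

Definition wave_phase (z : R[i]) (t : R) : R[i] := cis t * cexp (- ('i%C * z)).

Lemma wave_phaseE z t : wave_phase z t = cexp ('i%C * (t%:C%C - z)).
Proof. by rewrite /wave_phase /cis cis_cexp -cexpD mulrBr. Qed.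

Lemma wave_phase_neq0 z t : wave_phase z t != 0.
Proof. by rewrite wave_phaseE cexp_neq0. Qed.

(** The modulus does not depend on t, hence the Jacobi-Anger expansion converges uniformly on
the circle. *)
Lemma normc_wave_phase z t : normc (wave_phase z t) = expR (complex.Im z).
Proof.
rewrite wave_phaseE normc_cexp !complexpE /=; congr expR.
by case: z => a b /=; ring.
Qed.

(** This is cos z cos t + sin z sin t = cos (t - z), written with exponentials. *)
Lemma plane_wave_circle z rho t : plane_wave kappa x0 z (circle_pt x0 rho t) =
  cexp (ja_exponent (wave_phase z t) * (kappa * rho)%:C%C).
Proof.
rewrite /plane_wave.
have -> : circle_pt x0 rho t - x0 = (rho * cos t, rho * sin t) :> plane R.
  by rewrite /circle_pt; case: x0 => a b; congr pair => /=; rewrite addrC addKr.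
congr cexp; rewrite /= /ja_exponent /ccos /csin /wave_phase.
rewrite [(cis t * _)^-1]invfM !cexpN invrK.
have c'E := cisV t.
have cosE : (cos t)%:C%C = (cis t + (cis t)^-1) / 2.
  rewrite c'E; apply: (mulIf (_ : (2 : R[i]) != 0)); rewrite ?pnatr_eq0// divfK ?pnatr_eq0//.
  by apply: complex_eqP; rewrite !complexpE /=; ring.
have sinE : (sin t)%:C%C = - 'i%C * (cis t - (cis t)^-1) / 2.
  rewrite c'E; apply: (mulIf (_ : (2 : R[i]) != 0)); rewrite ?pnatr_eq0// divfK ?pnatr_eq0//.
  by apply: complex_eqP; rewrite !complexpE /=; ring.
have iV : (2%:R * 'i%C : R[i])^-1 = - 'i%C / 2 by rewrite invfM complex_invi mulrC.
rewrite iV !rmorphM/= cosE sinE.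
set w := cis t; set w' := w^-1; set Z := cexp ('i%C * z); set Z' := Z^-1.
have ii := complex_sqr_i R.
transitivity ('i%C * kappa%:C%C * rho%:C%C *
  ((Z + Z') * (w + w') + ('i%C * 'i%C) * (Z - Z') * (w - w')) / 4).
  by rewrite -/w'; field.
by rewrite ii; field.
Qed.

End CircleTraces.


(** * Integrals over the circle and L^2 sums *)

Section CircleIntegrals.
Variables (R : realType) (h : R) (x0 : plane R).
Hypothesis h_gt0 : 0 < h.
Implicit Types (F G : plane R -> R) (f g : plane R -> R[i]).

Local Notation arc := (`[0%R, (2 * pi)%R]%classic : set R).

Definition rcircle_measurable F :=
  measurable_fun arc (fun t : R => F (circle_pt x0 h t)).

Let mE F : rcircle_measurable F ->
  measurable_fun arc (fun t => (F (circle_pt x0 h t))%:E).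
Proof. by move=> mF; exact/measurable_EFinP. Qed.

Lemma circle_int_ge0 F : (forall x, 0 <= F x) -> (0 <= circle_int x0 h F)%E.
Proof.
move=> F0; rewrite /circle_int; apply: mule_ge0; first by rewrite lee_fin ltW.
by apply: integral_ge0 => t _; rewrite lee_fin.
Qed.

Lemma eq_circle_int F G :
  (forall t, F (circle_pt x0 h t) = G (circle_pt x0 h t)) ->
  circle_int x0 h F = circle_int x0 h G.
Proof.
by move=> FG; rewrite /circle_int; congr (_ * _)%E; apply: eq_integral => t _;
  rewrite FG.
Qed.

Lemma le_circle_int F G : (forall x, 0 <= F x) ->
  rcircle_measurable F -> rcircle_measurable G ->
  (forall t, F (circle_pt x0 h t) <= G (circle_pt x0 h t)) ->
  (circle_int x0 h F <= circle_int x0 h G)%E.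
Proof.
move=> F0 mF mG FG; rewrite /circle_int lee_pmul2l// ?lte_fin//.
apply: ge0_le_integral => //; [|exact: mE..|].
- by move=> t _; rewrite lee_fin.
- by move=> t _; rewrite lee_fin.
Qed.

Lemma circle_intD F G : (forall x, 0 <= F x) -> (forall x, 0 <= G x) ->
  rcircle_measurable F -> rcircle_measurable G ->
  circle_int x0 h (fun x => F x + G x) = (circle_int x0 h F + circle_int x0 h G)%E.
Proof.
move=> F0 G0 mF mG; rewrite /circle_int -ge0_muleDr; last 2 first.
- by apply: integral_ge0 => t _; rewrite lee_fin.
- by apply: integral_ge0 => t _; rewrite lee_fin.
congr (_ * _)%E; under eq_integral do rewrite EFinD.
by apply: ge0_integralD => //; try exact: mE; move=> t _; rewrite lee_fin.
Qed.

Lemma circle_intZ F (k : R) : 0 <= k -> (forall x, 0 <= F x) ->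
  rcircle_measurable F ->
  circle_int x0 h (fun x => k * F x) = (k%:E * circle_int x0 h F)%E.
Proof.
move=> k0 F0 mF; rewrite /circle_int muleCA; congr (_ * _)%E.
under eq_integral do rewrite EFinM.
by apply: ge0_integralZl_EFin => //; [move=> t _; rewrite lee_fin|exact: mE].
Qed.

Lemma circle_int_cst (k : R) : circle_int x0 h (fun=> k) = (h * (k * (2 * pi)))%:E.
Proof.
rewrite /circle_int integral_cst//= lebesgue_measure_itv/= lte_fin.
by rewrite mulr_gt0 ?pi_gt0// sube0 !EFinM.
Qed.

Lemma rcircle_measurableD F G : rcircle_measurable F -> rcircle_measurable G ->
  rcircle_measurable (fun x => F x + G x).
Proof. by move=> mF mG; exact: measurable_funD. Qed.

Lemma rcircle_measurableZ F (k : R) : rcircle_measurable F ->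
  rcircle_measurable (fun x => k * F x).
Proof. by move=> mF; apply: measurable_funM => //; exact: measurable_cst. Qed.

Lemma rcircle_measurable_normc2 f : circle_measurable x0 h f ->
  rcircle_measurable (fun x => normc (f x) ^+ 2).
Proof.
move=> [mr mi]; apply: eq_measurable_fun (measurable_funD (measurable_funX 2 mr)
  (measurable_funX 2 mi)) => t _.
by rewrite normc2E.
Qed.

Lemma circle_measurableD f g : circle_measurable x0 h f -> circle_measurable x0 h g ->
  circle_measurable x0 h (fun x => f x + g x).
Proof.
move=> [fr fi] [gr gi]; split.
- by apply: eq_measurable_fun (measurable_funD fr gr) => t _; rewrite complexpE.
- by apply: eq_measurable_fun (measurable_funD fi gi) => t _; rewrite complexpE.
Qed.

Lemma circle_measurableZ (c : R[i]) f : circle_measurable x0 h f ->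
  circle_measurable x0 h (fun x => c * f x).
Proof.
move=> [fr fi]; pose fR x := complex.Re (f x); pose fI x := complex.Im (f x).
have mR k : rcircle_measurable (fun x => k * fR x) by exact: rcircle_measurableZ.
have mI k : rcircle_measurable (fun x => k * fI x) by exact: rcircle_measurableZ.
split.
- have := measurable_funB (mR (complex.Re c)) (mI (complex.Im c)).
  by apply: eq_measurable_fun => t _; rewrite complexpE.
- have := measurable_funD (mI (complex.Re c)) (mR (complex.Im c)).
  by apply: eq_measurable_fun => t _; rewrite complexpE.
Qed.

Lemma circle_measurableB f g : circle_measurable x0 h f -> circle_measurable x0 h g ->
  circle_measurable x0 h (fun x => f x - g x).
Proof.
move=> mf mg.
have -> : (fun x => f x - g x) = (fun x => f x + (-1) * g x).
  by apply/funext => x; rewrite mulN1r.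
exact: circle_measurableD (circle_measurableZ _ mg).
Qed.

Lemma circle_measurable_cst (c : R[i]) : circle_measurable x0 h (fun=> c).
Proof. by split; exact: measurable_cst. Qed.

Lemma circle_measurable_isum (F : int -> plane R -> R[i]) N :
  (forall m, circle_measurable x0 h (F m)) ->
  circle_measurable x0 h (fun x => isum N (F^~ x)).
Proof.
move=> mF; elim: N => [|N IH].
  by rewrite (_ : (fun x => _) = F 0)//; apply/funext => x; rewrite isum0.
rewrite (_ : (fun x => _) =
    fun x => F (- N.+1%:Z) x + isum N (F^~ x) + F N.+1%:Z x); last first.
  by apply/funext => x; rewrite isumS.
by apply: circle_measurableD => //; exact: circle_measurableD.
Qed.

Lemma circle_measurable_cderive f :
  (forall t, exists d, is_cderive t (fun t => f (circle_pt x0 h t)) d) ->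
  circle_measurable x0 h f.
Proof.
move=> fd; split; apply: measurable_funTS; apply: continuous_measurable_fun => t;
  by apply/differentiable_continuous/derivable1_diffP; case: (fd t) => d [].
Qed.

End CircleIntegrals.

Section CircleL2Sums.
Variables (R : realType) (h : R) (x0 : plane R).
Hypothesis h_gt0 : 0 < h.
Implicit Types (F G : int -> plane R -> R[i]) (f g : plane R -> R[i]).

(** Measurability of the summands makes the integral monotone and additive on the squared
distances to the partial sums. *)
Definition circle_L2_series F f :=
  (forall m, circle_measurable x0 h (F m)) /\ circle_L2_sum x0 h F f.

Lemma circle_L2_seriesD F G f g : circle_L2_series F f -> circle_L2_series G g ->
  circle_L2_series (fun m x => F m x + G m x) (fun x => f x + g x).
Proof.
move=> [mF [mf Ff]] [mG [mg Gg]]; split; first by move=> m; exact: circle_measurableD.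
split; first exact: circle_measurableD.
pose rf N x := f x - isum N (F^~ x); pose rg N x := g x - isum N (G^~ x).
have mrf N : circle_measurable x0 h (rf N).
  exact: circle_measurableB (circle_measurable_isum _ _).
have mrg N : circle_measurable x0 h (rg N).
  exact: circle_measurableB (circle_measurable_isum _ _).
pose sq (r : plane R -> R[i]) x : R := normc (r x) ^+ 2.
have lim0 : (fun N => 2%:E * circle_int x0 h (sq (rf N)) +
    2%:E * circle_int x0 h (sq (rg N)))%E @ \oo --> (0 : \bar R)%E.
  have F2 := @cvgeZl _ _ R _ 0%E 2%:E isT Ff.
  have G2 := @cvgeZl _ _ R _ 0%E 2%:E isT Gg.
  rewrite mule0 in F2; rewrite mule0 in G2.
  by rewrite -[0%E in X in _ --> X]adde0; apply: cvgeD F2 G2.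
apply: (squeeze_cvge _ (cvg_cst _) lim0); apply: nearW => N.
rewrite circle_int_ge0//=; last by move=> x; rewrite sqr_ge0.
have m2 r : circle_measurable x0 h r ->
    rcircle_measurable h x0 (fun x => 2 * normc (r x) ^+ 2).
  by move=> mr; apply: rcircle_measurableZ; exact: rcircle_measurable_normc2.
have p2 (r : plane R -> R[i]) x : 0 <= normc (r x) ^+ 2 by rewrite sqr_ge0.
have p2' (r : plane R -> R[i]) x : 0 <= 2 * normc (r x) ^+ 2.
  exact: mulr_ge0 (ler0n _ 2) (sqr_ge0 _).
have sq0 r x : 0 <= sq r x by exact: p2.
have sq2 r x : 0 <= 2 * sq r x by exact: p2'.
rewrite -!circle_intZ//; try exact: rcircle_measurable_normc2.
rewrite -circle_intD//; try exact: m2.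
have E x : f x + g x - symsum N (fun m => F m x + G m x) = rf N x + rg N x.
  by rewrite /rf /rg addrACA -opprD -isumD.
under [fun x => _]eq_fun do rewrite E.
apply: le_circle_int => //.
- by move=> x; exact: sqr_ge0.
- by apply: rcircle_measurable_normc2; exact: circle_measurableD.
- by apply: rcircle_measurableD; exact: m2.
- move=> t; apply: le_trans (normc2D_le _ _ (@ltr01 R)) _.
  by rewrite invr1.
Qed.

Lemma circle_L2_seriesZ (c : R[i]) F f : circle_L2_series F f ->
  circle_L2_series (fun m x => c * F m x) (fun x => c * f x).
Proof.
move=> [mF [mf Ff]]; split; first by move=> m; exact: circle_measurableZ.
split; first exact: circle_measurableZ.
have -> : (fun N => circle_int x0 h (fun x =>
    normc (c * f x - symsum N (fun m => c * F m x)) ^+ 2)) =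
  (fun N => (normc c ^+ 2)%:E * circle_int x0 h (fun x =>
    (normc (f x - symsum N (F^~ x)) ^+ 2)%R))%E.
  apply/funext => N; rewrite -circle_intZ ?sqr_ge0//.
  - apply: eq_circle_int => t; rewrite -exprMn -normcM mulrBr.
    by congr (normc (_ - _) ^+ 2); exact: isumZ.
  - by move=> x; rewrite sqr_ge0.
  - apply: rcircle_measurable_normc2; apply: circle_measurableB => //.
    exact: circle_measurable_isum.
have := @cvgeZl _ _ R _ 0%E (normc c ^+ 2)%:E isT Ff.
by rewrite mule0.
Qed.

Lemma circle_L2_series0 : circle_L2_series (fun _ _ => 0) (fun=> 0).
Proof.
split; first by move=> m; exact: circle_measurable_cst.
split; first exact: circle_measurable_cst.
apply: cvg_near_cst; apply: nearW => N.
rewrite -[RHS](_ : circle_int x0 h (fun=> 0) = 0%E).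
  apply: eq_circle_int => t; rewrite sub0r /symsum big1 ?oppr0 ?normc0 ?expr0n//.
by rewrite circle_int_cst mul0r mulr0.
Qed.

Lemma circle_L2_series_sum n (F : 'I_n -> int -> plane R -> R[i])
    (f : 'I_n -> plane R -> R[i]) :
  (forall j, circle_L2_series (F j) (f j)) ->
  circle_L2_series (fun m x => \sum_(j < n) F j m x) (fun x => \sum_(j < n) f j x).
Proof.
elim: n F f => [|n IH] F f Ff.
  under eq_fun do under eq_fun do rewrite big_ord0.
  by under [X in circle_L2_series _ X]eq_fun do rewrite big_ord0; exact: circle_L2_series0.
under eq_fun do under eq_fun do rewrite big_ord_recr.
under [X in circle_L2_series _ X]eq_fun do rewrite big_ord_recr.
by apply: circle_L2_seriesD; [apply: IH|].
Qed.

Lemma circle_L2_series_uniform F f (e : nat -> R) :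
  (forall m, circle_measurable x0 h (F m)) -> circle_measurable x0 h f ->
  (forall N t, normc (f (circle_pt x0 h t) - isum N (F^~ (circle_pt x0 h t))) <= e N) ->
  e @ \oo --> (0 : R) -> circle_L2_series F f.
Proof.
move=> mF mf Fe e0; split => //; split => //.
have lim0 : (fun N => (h * (e N ^+ 2 * (2 * pi)))%:E) @ \oo --> (0 : \bar R)%E.
  apply: cvg_EFin; first by apply: nearW.
  rewrite -[X in _ --> X](_ : h * (0 * 0 * (2 * pi)) = 0); last by rewrite !mul0r mulr0.
  by apply: cvgMl_tmp; apply: cvgMr_tmp; apply: cvgM.
apply: (squeeze_cvge _ (cvg_cst _) lim0); apply: nearW => N.
rewrite circle_int_ge0//=; last by move=> x; rewrite sqr_ge0.
rewrite -(circle_int_cst _ x0); apply: le_circle_int => //.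
- by move=> x; rewrite sqr_ge0.
- apply: rcircle_measurable_normc2; apply: circle_measurableB => //.
  exact: circle_measurable_isum.
- exact: measurable_cst.
- move=> t; rewrite lerXn2r ?nnegrE ?normc_ge0//; last exact: Fe.
  exact: le_trans (normc_ge0 _) (Fe N t).
Qed.

End CircleL2Sums.


(** * Orthogonality of the exponentials *)

Section TrigonometricSums.
Variable R : realType.
Implicit Types (f g : R -> R[i]) (J K : R[i]) (N : nat) (m k : int).

(** Integrals over a period are computed from primitives, which are closed
under the complex linear combinations of exponentials that occur here. *)
Definition period_int f J := exists g, [/\ forall t, is_cderive t g (f t),
  forall t, exists d, is_cderive t f d & g (2 * pi) - g 0 = J].

Lemma period_intD f g J K : period_int f J -> period_int g K ->
  period_int (fun t => f t + g t) (J + K).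
Proof.
move=> [F [Ff df <-]] [G [Gg dg <-]]; exists (fun t => F t + G t).
split; first by move=> t; exact: is_cderiveD.
- move=> t; have [d fd] := df t; have [e ge] := dg t.
  by exists (d + e); exact: is_cderiveD.
- by rewrite opprD addrACA.
Qed.

Lemma period_intZ f J (c : R[i]) : period_int f J ->
  period_int (fun t => c * f t) (c * J).
Proof.
move=> [F [Ff df <-]]; exists (fun t => c * F t).
split; first by move=> t; exact: is_cderiveZ.
- by move=> t; have [d fd] := df t; exists (c * d); exact: is_cderiveZ.
- by rewrite mulrBr.
Qed.

Lemma period_int_isum (F : int -> R -> R[i]) (D : int -> R[i]) N :
  (forall m, period_int (F m) (D m)) ->
  period_int (fun t => isum N (F^~ t)) (isum N D).
Proof.
move=> FD; elim: N => [|N IH].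
  rewrite isum0 (_ : (fun t => _) = F 0)//.
  by apply/funext => t; rewrite isum0.
rewrite isumS (_ : (fun t => _) =
    fun t => F (- N.+1%:Z) t + isum N (F^~ t) + F N.+1%:Z t); last first.
  by apply/funext => t; rewrite isumS.
by apply: period_intD => //; exact: period_intD.
Qed.

Lemma cis_exprz (t : R) m : cis t ^ m = cexp ('i%C * m%:~R * t%:C%C).
Proof. by rewrite /cis cis_cexp -cexp_mulz mulrCA mulrA. Qed.

Lemma period_int_cis m :
  period_int (fun t : R => cis t ^ m) (if m == 0 then (2 * pi)%:C%C else 0).
Proof.
pose c : R[i] := 'i%C * m%:~R.
have cisE : (fun t : R => cis t ^ m) = fun t => cexp (c * t%:C%C).
  by apply/funext => t; rewrite cis_exprz.
have dcis t : exists d, is_cderive t (fun t : R => cis t ^ m) d.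
  by rewrite cisE; eexists; exact: is_cderive_cexp.
have [m0|m0] := eqVneq m 0.
  exists (fun t => t%:C%C); split=> // [t|]; last by rewrite subr0.
  by rewrite m0 expr0z; exact: (is_cderive_real (is_derive_id t (1 : R))).
have c0 : c != 0 by rewrite mulf_neq0 ?complex_i_neq0// intr_eq0.
exists (fun t => c^-1 * cexp (c * t%:C%C)); split => // [t|].
- apply: is_cderive_eq (is_cderiveZ c^-1 (is_cderive_cexp t c)) _.
  by rewrite mulrA mulVf// mul1r cis_exprz.
- by rewrite cexp_mulz_period mulr0 cexp0 subrr.
Qed.

Lemma integral_period f J (r : R -> R) : period_int f J ->
  (forall t, f t = (r t)%:C%C) ->
  (\int[@lebesgue_measure R]_(t in `[0%R, (2 * pi)%R]%classic) (r t)%:E =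
  (complex.Re J)%:E)%E.
Proof.
move=> [g [gf df <-]] fr.
have rE : r = fun t => complex.Re (f t) by apply/funext => t; rewrite fr.
have cg t : {for t, continuous (fun t => complex.Re (g t))}.
  by apply/differentiable_continuous/derivable1_diffP; case: (gf t).
rewrite (@continuous_FTC2 _ r (fun t => complex.Re (g t))).
- by rewrite !complexpE EFinB.
- by rewrite mulr_gt0 ?pi_gt0.
- apply: continuous_subspaceT => t; rewrite rE.
  by apply/differentiable_continuous/derivable1_diffP; case: (df t) => d [].
- split.
  + by move=> t _; case: (gf t).
  + by apply: cvg_at_right_filter; exact: cg.
  + by apply: cvg_at_left_filter; exact: cg.
- move=> t _; rewrite derive1E rE; case: (gf t) => gt _.
  by rewrite derive_val.
Qed.

Lemma isum_delta (V : zmodType) N m (G : int -> V) : (`|m| <= N)%N ->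
  isum N (fun k => if m - k == 0 then G k else 0) = G m.
Proof.
elim: N m => [|N IH] m mN.
  have -> : m = 0 by apply/eqP; rewrite -absz_eq0 -leqn0.
  by rewrite isum0 subr0 eqxx.
rewrite isumS.
have z0 (k : int) : k != m -> (if m - k == 0 then G k else 0) = 0.
  by move=> km; rewrite subr_eq0 eq_sym (negbTE km).
have zS : (N < `|m|)%N -> isum N (fun k => if m - k == 0 then G k else 0) = 0.
  move=> Nm; rewrite (@eq_isum _ N _ (fun=> 0)) => [|k kN]; first exact: big1.
  by rewrite z0//; lia.
have [mE|mE] := eqVneq m N.+1%:Z.
  rewrite zS ?(z0 (- N.+1%:Z)); [|lia..].
  by rewrite !add0r -mE subrr eqxx.
have [mE'|mE'] := eqVneq m (- N.+1%:Z).
  rewrite zS ?(z0 N.+1%:Z); [|lia..].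
  by rewrite !addr0 -mE' subrr eqxx.
rewrite !z0 ?add0r ?addr0 1?eq_sym//.
by apply: IH; lia.
Qed.

Lemma normc2_conj (x : R[i]) : (normc x ^+ 2)%:C%C = x * conjc x.
Proof.
rewrite normc2E; case: x => a b; apply: complex_eqP; rewrite complexpE/=; ring.
Qed.

Lemma conjc_cis (t : R) m : conjc (cis t ^ m) = cis t ^ (- m).
Proof.
have cE : conjc (cis t) = cis t ^ (-1) by rewrite exprN1 cisV.
by rewrite fmorphXz -[X in X ^ m]/(conjc (cis t)) cE exprz_exp mulN1r.
Qed.

(** Parseval's identity: of the products e^(imt) e^(-ikt) only the diagonal ones have a
nonzero mean. *)
Lemma integral_trig_sum N (b : int -> R[i]) :
  (\int[@lebesgue_measure R]_(t in `[0%R, (2 * pi)%R]%classic)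
    (normc (isum N (fun m => (b m * cis t ^ m)%R)) ^+ 2)%:E =
  (2 * pi * isum N (fun m => (normc (b m) ^+ 2)%R))%:E)%E.
Proof.
have cu (t : R) : cis t \is a GRing.unit.
  by rewrite unitfE /cis cis_cexp cexp_neq0.
pose D m : R[i] := isum N (fun k => b m * conjc (b k) *
  (if m - k == 0 then (2 * pi)%:C%C else 0)).
have pD : period_int (fun t => isum N (fun m => isum N (fun k =>
    b m * conjc (b k) * cis t ^ (m - k)))) (isum N D).
  apply: (period_int_isum (F := fun m t => isum N (fun k =>
    b m * conjc (b k) * cis t ^ (m - k)))) => m.
  apply: (period_int_isum (F := fun k t =>
    b m * conjc (b k) * cis t ^ (m - k))) => k.
  exact/period_intZ/period_int_cis.
rewrite (integral_period pD) => [|t]; last first.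
  rewrite normc2_conj.
  have -> : conjc (isum N (fun m => b m * cis t ^ m)) =
      isum N (fun k => conjc (b k) * cis t ^ (- k)).
    rewrite [LHS]rmorph_sum; apply: eq_bigr => k _.
    by rewrite -conjc_cis; exact: rmorphM.
  rewrite {1}/isum mulr_suml; apply: eq_bigr => i _.
  rewrite mulr_sumr; apply: eq_bigr => j _.
  by rewrite (exprzDr (cu t) (i%:Z - N%:Z)); ring.
congr (_%:E); rewrite -[RHS]/(complex.Re (2 * pi * isum N (fun m => normc (b m) ^+ 2))%:C%C).
congr complex.Re.
have -> : (2 * pi * isum N (fun m => normc (b m) ^+ 2))%:C%C =
    isum N (fun m => (2 * pi)%:C%C * (normc (b m) ^+ 2)%:C%C).
  by rewrite rmorphM /isum rmorph_sum mulr_sumr.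
apply: eq_isum => m mN.
rewrite normc2_conj mulrC -[RHS](isum_delta
  (fun k => b m * conjc (b k) * (2 * pi)%:C%C) mN).
by apply: eq_isum => k _; case: ifP; rewrite ?mulr0.
Qed.

End TrigonometricSums.


(** * Unconditional sums over the integers *)

Section SymmetricSumsLimit.
Variable R : realType.
Implicit Types (F : int -> R) (N : nat).

Lemma isum_seq N F : (isum N F)%:E =
  (\sum_(m \in [set m : int | (`|m| <= N)%N]) (F m)%:E)%E.
Proof.
pose s := [seq k%:Z - N%:Z | k <- iota 0 N.*2.+1].
have su : uniq s.
  by rewrite map_inj_uniq ?iota_uniq// => i j /addIr [].
have -> : [set m : int | (`|m| <= N)%N] = [set` s].
  apply/seteqP; split => m /=.
    move=> mN; apply/mapP; exists (absz (m + N%:Z)); last by lia.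
    by rewrite mem_iota; lia.
  by move=> /mapP[k]; rewrite mem_iota => /andP[_ kN] ->; lia.
rewrite -fsbig_seq// /s big_map -{1}[N.*2.+1]subn0 -/(index_iota 0 N.*2.+1).
by rewrite /isum -sumEFin big_mkord.
Qed.

(** Every finite set of integers is contained in some [-N, N]. *)
Lemma cvg_isum_esum F : (forall m, 0 <= F m) ->
  (fun N => (isum N F)%:E) @ \oo --> (\esum_(m in [set: int]) (F m)%:E)%E.
Proof.
move=> F0; have F0E m : (0 <= (F m)%:E)%E by rewrite lee_fin.
have fin N : finite_set [set m : int | (`|m| <= N)%N].
  pose s := [seq k%:Z - N%:Z | k <- iota 0 N.*2.+1].
  apply: (@sub_finite_set _ _ [set` s]); last exact: finite_seq.
  move=> m /= mN; apply/mapP; exists (absz (m + N%:Z)); last by lia.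
  by rewrite mem_iota; lia.
have -> : (\esum_(m in [set: int]) (F m)%:E =
    ereal_sup (range (fun N => (isum N F)%:E)))%E.
  apply/eqP; rewrite eq_le; apply/andP; split.
  - apply: ge_ereal_sup => _ [A [/finite_fsetP[X ->] _] <-].
    pose N := (\max_(m <- finmap.enum_fset X) absz m)%N.
    apply: le_trans (ereal_sup_ubound _); last by exists N.
    rewrite isum_seq; apply: lee_fsum_nneg_subset => //.
    by move=> m; rewrite !inE => mX; rewrite /N; exact: leq_bigmax_seq.
  - apply: ge_ereal_sup => _ [N _ <-]; apply: ereal_sup_ubound.
    by rewrite isum_seq; exists [set m : int | (`|m| <= N)%N].
apply: ereal_nondecreasing_cvgn; apply/nondecreasing_seqP => N.
by rewrite lee_fin isumS addrAC ler_wpDl// addr_ge0.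
Qed.

End SymmetricSumsLimit.


(** * Parseval's identity for the trace norm *)

Section TraceNorm.
Variables (R : realType) (kappa h : R) (x0 : plane R).
Hypotheses (kappa_gt0 : 0 < kappa) (h_gt0 : 0 < h).
Implicit Types (f g : plane R -> R[i]) (a : int -> R[i]).

Let sq f (x : plane R) : R := normc (f x) ^+ 2.

Let sq_ge0 f x : 0 <= sq f x. Proof. exact: sqr_ge0. Qed.

Let msq f : circle_measurable x0 h f -> rcircle_measurable h x0 (sq f).
Proof. exact: rcircle_measurable_normc2. Qed.

Lemma trace_norm2E f g : circle_measurable x0 h f -> circle_measurable x0 h g ->
  trace_norm2 kappa x0 h f g =
  (kappa%:E * circle_int x0 h (fun x => (normc (f x) ^+ 2)%R) +
   kappa^-1%:E * circle_int x0 h (fun x => (normc (g x) ^+ 2)%R))%E.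
Proof.
move=> mf mg; have k0 := ltW kappa_gt0.
have k0' : 0 <= kappa^-1 by rewrite invr_ge0.
rewrite -(circle_intZ k0 (sq_ge0 f) (msq mf)) -(circle_intZ k0' (sq_ge0 g) (msq mg)).
rewrite -circle_intD//.
- by move=> x; rewrite mulr_ge0.
- by move=> x; rewrite mulr_ge0.
- exact: rcircle_measurableZ (msq mf).
- exact: rcircle_measurableZ (msq mg).
Qed.

Lemma trace_norm2_ge0 f g : (0 <= trace_norm2 kappa x0 h f g)%E.
Proof.
apply: circle_int_ge0 => // x.
by apply: addr_ge0; apply: mulr_ge0; rewrite ?invr_ge0 ?(ltW kappa_gt0)//;
  exact: sqr_ge0.
Qed.

(** The factor 1 of the first term on the right and the freedom to take r close to 1 are
what limit arguments need. *)
Lemma trace_norm2_young (r : R) f1 g1 f2 g2 : 0 < r < 1 ->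
  circle_measurable x0 h f1 -> circle_measurable x0 h g1 ->
  circle_measurable x0 h f2 -> circle_measurable x0 h g2 ->
  (r%:E * trace_norm2 kappa x0 h (fun x => (f1 x + f2 x)%R) (fun x => (g1 x + g2 x)%R)
   <= trace_norm2 kappa x0 h f1 g1 +
      (r / (1 - r))%:E * trace_norm2 kappa x0 h f2 g2)%E.
Proof.
move=> /andP[r0 r1] mf1 mg1 mf2 mg2.
have s0 : 0 < 1 - r by rewrite subr_gt0.
have rs0 : 0 <= r / (1 - r) by rewrite divr_ge0 ?ltW.
pose den f g x : R := kappa * normc (f x) ^+ 2 + kappa^-1 * normc (g x) ^+ 2.
have den0 f g x : 0 <= den f g x.
  by apply: addr_ge0; apply: mulr_ge0; rewrite ?invr_ge0 ?(ltW kappa_gt0)//;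
    exact: sqr_ge0.
have mden f g : circle_measurable x0 h f -> circle_measurable x0 h g ->
    rcircle_measurable h x0 (den f g).
  move=> mf mg.
  exact: rcircle_measurableD (rcircle_measurableZ _ (msq mf))
    (rcircle_measurableZ _ (msq mg)).
have den0' f g x : 0 <= r / (1 - r) * den f g x by rewrite mulr_ge0.
have m12 := mden _ _ (circle_measurableD mf1 mf2) (circle_measurableD mg1 mg2).
have m1 := mden _ _ mf1 mg1; have m2 := mden _ _ mf2 mg2.
have tE f g : trace_norm2 kappa x0 h f g = circle_int x0 h (den f g) by [].
rewrite !tE -!circle_intZ ?(ltW r0)//.
rewrite -circle_intD//; last exact: rcircle_measurableZ.
apply: le_circle_int => //.
- move=> x; apply: mulr_ge0; first exact: ltW.
  exact: (den0 (fun x => f1 x + f2 x) (fun x => g1 x + g2 x)).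
- exact: rcircle_measurableZ m12.
- exact: rcircle_measurableD m1 (rcircle_measurableZ _ m2).
move=> t; set x := circle_pt _ _ _.
have young (y z : R[i]) : r * normc (y + z) ^+ 2 <=
    normc y ^+ 2 + r / (1 - r) * normc z ^+ 2.
  have e0 : 0 < (1 - r) / r by rewrite divr_gt0.
  have := ler_wpM2l (ltW r0) (normc2D_le y z e0); move/le_trans; apply.
  rewrite le_eqVlt; apply/orP; left; apply/eqP; field.
  by rewrite !gt_eqF.
have := lerD (ler_wpM2l (ltW kappa_gt0) (young (f1 x) (f2 x)))
  (ler_wpM2l (_ : 0 <= kappa^-1) (young (g1 x) (g2 x))).
rewrite invr_ge0 (ltW kappa_gt0) => /(_ isT) H.
by apply: le_trans (le_trans _ H) _; rewrite le_eqVlt; apply/orP; left; apply/eqP;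
  rewrite /den; ring.
Qed.

Definition fb_value a m x : R[i] := a m * fourier_bessel kappa x0 m x.

Definition fb_normal a m x : R[i] :=
  a m * normal_derive x0 h (fourier_bessel kappa x0 m) x.

Lemma circle_measurable_cis f (b : R[i]) m :
  (forall t, f (circle_pt x0 h t) = b * cis t ^ m) -> circle_measurable x0 h f.
Proof.
move=> fE; apply: circle_measurable_cderive => t.
exists (b * ('i%C * m%:~R * cexp ('i%C * m%:~R * t%:C%C))).
rewrite (_ : (fun t => _) = fun t : R => b * cexp ('i%C * m%:~R * t%:C%C)).
  by apply: is_cderiveZ; exact: is_cderive_cexp.
by apply/funext => s; rewrite fE cis_exprz.
Qed.

Lemma fb_value_circle a m t : fb_value a m (circle_pt x0 h t) =
  a m * (besselJ m (kappa * h))%:C%C * cis t ^ m.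
Proof. by rewrite /fb_value fourier_bessel_circle// mulrA. Qed.

Lemma fb_normal_circle a m t : fb_normal a m (circle_pt x0 h t) =
  a m * (kappa * derive1 (besselJ m) (kappa * h))%:C%C * cis t ^ m.
Proof. by rewrite /fb_normal normal_derive_fourier_bessel// mulrA. Qed.

Lemma fb_value_measurable a m : circle_measurable x0 h (fb_value a m).
Proof. by apply: circle_measurable_cis => t; exact: fb_value_circle. Qed.

Lemma fb_normal_measurable a m : circle_measurable x0 h (fb_normal a m).
Proof. by apply: circle_measurable_cis => t; exact: fb_normal_circle. Qed.

(** [cauchy_data] in a form that is closed under linear combinations. *)
Definition cauchy_series a f g :=
  circle_L2_series h x0 (fb_value a) f /\ circle_L2_series h x0 (fb_normal a) g.

Lemma cauchy_seriesP a f g : cauchy_data kappa x0 h a f g <-> cauchy_series a f g.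
Proof.
split=> [[F G]|[[_ F] [_ G]]]; last by split.
by split; split=> [m|]; [exact: fb_value_measurable|exact: F|
  exact: fb_normal_measurable|exact: G].
Qed.

Lemma circle_int_trig N f (b : int -> R[i]) :
  (forall t, f (circle_pt x0 h t) = isum N (fun m => b m * cis t ^ m)) ->
  circle_int x0 h (fun x => normc (f x) ^+ 2) =
  (h * (2 * pi * isum N (fun m => normc (b m) ^+ 2)))%:E.
Proof.
move=> fE; rewrite /circle_int EFinM; congr (_ * _)%E.
by rewrite -integral_trig_sum; apply: eq_integral => t _; rewrite fE.
Qed.

Lemma tau2E m : tau kappa h m ^+ 2 = 2 * pi * h * kappa *
  (besselJ m (kappa * h) ^+ 2 + derive1 (besselJ m) (kappa * h) ^+ 2).
Proof.
rewrite sqr_sqrtr// mulr_ge0 ?addr_ge0 ?sqr_ge0// !mulr_ge0 ?ltW//.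
by rewrite pi_gt0.
Qed.

Lemma trace_norm2_partial_sum a N :
  trace_norm2 kappa x0 h (fun x => isum N (fb_value a ^~ x))
    (fun x => isum N (fb_normal a ^~ x)) =
  (isum N (fun m => normc (a m) ^+ 2 * tau kappa h m ^+ 2))%:E.
Proof.
have mS : circle_measurable x0 h (fun x => isum N (fb_value a ^~ x)).
  by apply: circle_measurable_isum => m; exact: fb_value_measurable.
have mS' : circle_measurable x0 h (fun x => isum N (fb_normal a ^~ x)).
  by apply: circle_measurable_isum => m; exact: fb_normal_measurable.
rewrite trace_norm2E//.
rewrite (circle_int_trig (b := fun m => a m * (besselJ m (kappa * h))%:C%C) (N := N));
  last by move=> t; apply: eq_isum => m _; exact: fb_value_circle.
rewrite (circle_int_trig (b := fun m => a m *
    (kappa * derive1 (besselJ m) (kappa * h))%:C%C) (N := N));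
  last by move=> t; apply: eq_isum => m _; exact: fb_normal_circle.
rewrite -!EFinM -EFinD; congr (_%:E).
rewrite /isum !mulr_sumr -big_split/=; apply: eq_bigr => k _.
rewrite tau2E !normcM !normc_real !exprMn !real_normK ?num_real//.
by field; rewrite gt_eqF.
Qed.

(** The squared norms of the partial sums are known by orthogonality, and Young's
inequality with a weight close to 1 carries them over to the limit. *)
Lemma trace_norm2_parseval a f g : cauchy_series a f g ->
  trace_norm2 kappa x0 h f g =
    (\esum_(m in [set: int]) (normc (a m) ^+ 2 * tau kappa h m ^+ 2)%:E)%E /\
  (trace_norm2 kappa x0 h f g < +oo)%E.
Proof.
move=> [[mF [mf Ff]] [mG [mg Gg]]].
set A := trace_norm2 kappa x0 h f g; set S := esum _ _.
pose s N x := isum N (fb_value a ^~ x); pose s' N x := isum N (fb_normal a ^~ x).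
pose T N := isum N (fun m => normc (a m) ^+ 2 * tau kappa h m ^+ 2).
pose r N := trace_norm2 kappa x0 h (fun x => f x - s N x) (fun x => g x - s' N x).
have ms N : circle_measurable x0 h (s N) by exact: circle_measurable_isum.
have ms' N : circle_measurable x0 h (s' N) by exact: circle_measurable_isum.
have md N : circle_measurable x0 h (fun x => f x - s N x) by exact: circle_measurableB.
have md' N : circle_measurable x0 h (fun x => g x - s' N x).
  exact: circle_measurableB.
have sT N : trace_norm2 kappa x0 h (s N) (s' N) = (T N)%:E.
  exact: trace_norm2_partial_sum.
have TS : (fun N => (T N)%:E) @ \oo --> S.
  by apply: cvg_isum_esum => m; rewrite mulr_ge0 ?sqr_ge0.
have r0 : r @ \oo --> (0 : \bar R)%E.
  have rE : r = fun N =>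
      (kappa%:E * circle_int x0 h (fun x => (normc (f x - symsum N (fb_value a ^~ x)) ^+ 2)%R) +
      kappa^-1%:E * circle_int x0 h (fun x => (normc (g x - symsum N (fb_normal a ^~ x)) ^+ 2)%R))%E.
    by apply/funext => N; rewrite /r trace_norm2E.
  rewrite rE; have F2 := @cvgeZl _ _ R _ 0%E kappa%:E isT Ff.
  have G2 := @cvgeZl _ _ R _ 0%E kappa^-1%:E isT Gg.
  rewrite mule0 in F2; rewrite mule0 in G2.
  by rewrite -[0%E in X in _ --> X]adde0; apply: cvgeD F2 G2.
have cr (c : R) : (fun N => c%:E * r N)%E @ \oo --> (0 : \bar R)%E.
  by have := @cvgeZl _ _ R _ 0%E c%:E isT r0; rewrite mule0.
have fsum N : f = fun x => s N x + (f x - s N x).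
  by apply/funext => x; rewrite addrC subrK.
have gsum N : g = fun x => s' N x + (g x - s' N x).
  by apply/funext => x; rewrite addrC subrK.
have up N (p : R) : 0 < p < 1 -> (p%:E * A <= (T N)%:E + (p / (1 - p))%:E * r N)%E.
  move=> p01; have := trace_norm2_young p01 (ms N) (ms' N) (md N) (md' N).
  by rewrite -fsum -gsum sT.
have low N (p : R) : 0 < p < 1 -> (p%:E * (T N)%:E <= A + (p / (1 - p))%:E * r N)%E.
  move=> p01.
  have := trace_norm2_young p01 mf mg (circle_measurableZ (-1) (md N))
    (circle_measurableZ (-1) (md' N)).
  rewrite -/A (_ : (fun x => f x + -1 * _) = s N); last first.
    by apply/funext => x; rewrite mulN1r opprB addrC subrK.
  rewrite (_ : (fun x => g x + -1 * _) = s' N); last first.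
    by apply/funext => x; rewrite mulN1r opprB addrC subrK.
  have -> : trace_norm2 kappa x0 h (fun x => -1 * (f x - s N x))
      (fun x => -1 * (g x - s' N x)) = r N.
    by apply: eq_circle_int => t; rewrite !mulN1r !normcN.
  by rewrite sT.
have A0 : (0 <= A)%E by exact: trace_norm2_ge0.
have S0 : (0 <= S)%E by apply: esum_ge0 => m _; rewrite lee_fin mulr_ge0 ?sqr_ge0.
have AS : (A <= S)%E.
  apply/lee_mul01Pr => // p p01.
  have lim1 : (fun N => (T N)%:E + (p / (1 - p))%:E * r N)%E @ \oo --> S.
    have d : (S +? 0)%E by exact: fin_num_adde_defl.
    by have := cvgeD d TS (cr (p / (1 - p))); rewrite adde0; apply.
  by apply: cvge_ge lim1; apply: nearW => N; exact: up.
have SA : (S <= A)%E.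
  apply/lee_mul01Pr => // p p01.
  have lim1 : (fun N => A + (p / (1 - p))%:E * r N)%E @ \oo --> A.
    have d : (A +? 0)%E by exact: fin_num_adde_defl.
    by have := cvgeD d (cvg_cst A) (cr (p / (1 - p))); rewrite adde0; apply.
  have lim2 : (fun N => p%:E * (T N)%:E)%E @ \oo --> (p%:E * S)%E.
    exact: cvgeZl.
  have := lee_lim (cvgP _ lim2) (cvgP _ lim1) _.
  rewrite (cvg_lim _ lim1)// (cvg_lim _ lim2)//; apply.
  by apply: nearW => N; exact: low.
split; first by apply/eqP; rewrite eq_le AS SA.
have [N _ rN] : \forall N \near \oo, (r N < 1)%E.
  have e1 : ((0 : \bar R) < 1)%E by exact: lte01.
  exact: r0 _ (open_ereal_lt' e1).
(* For finiteness any fixed weight will do, together with one partial sum at finite distance. *)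
have h01 : 0 < (2^-1 : R) < 1 by rewrite invr_gt0 ltr0n invf_lt1 ?ltr1n// ltr0n.
have := up N (2^-1) h01; have := rN N (leqnn N).
case: (A) A0 => [x _ _ _|_ rN1|//]; first by rewrite ltry.
have : r N \is a fin_num.
  by rewrite ge0_fin_numE ?trace_norm2_ge0// (lt_trans rN1)// ltry.
move=> /fineK <-; rewrite -EFinM -EFinD gt0_muley ?lte_fin ?invr_gt0//.
Qed.

End TraceNorm.


(** * Cauchy data of trial fields *)

Section CauchySeries.
Variables (R : realType) (kappa h : R) (x0 : plane R).
Hypotheses (kappa_gt0 : 0 < kappa) (h_gt0 : 0 < h).
Implicit Types (f g : plane R -> R[i]) (a : int -> R[i]).

Local Notation cauchy_series := (cauchy_series kappa h x0).

Lemma cauchy_seriesD a a' f f' g g' : cauchy_series a f g -> cauchy_series a' f' g' ->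
  cauchy_series (fun m => a m + a' m) (fun x => f x + f' x) (fun x => g x + g' x).
Proof.
move=> [F G] [F' G']; split.
- have -> : fb_value kappa x0 (fun m => a m + a' m) =
      fun m x => fb_value kappa x0 a m x + fb_value kappa x0 a' m x.
    by apply/funext => m; apply/funext => x; rewrite /fb_value mulrDl.
  exact: circle_L2_seriesD.
- have -> : fb_normal kappa h x0 (fun m => a m + a' m) =
      fun m x => fb_normal kappa h x0 a m x + fb_normal kappa h x0 a' m x.
    by apply/funext => m; apply/funext => x; rewrite /fb_normal mulrDl.
  exact: circle_L2_seriesD.
Qed.

Lemma cauchy_seriesZ (c : R[i]) a f g : cauchy_series a f g ->
  cauchy_series (fun m => c * a m) (fun x => c * f x) (fun x => c * g x).
Proof.
move=> [F G]; split.
- have -> : fb_value kappa x0 (fun m => c * a m) =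
      fun m x => c * fb_value kappa x0 a m x.
    by apply/funext => m; apply/funext => x; rewrite /fb_value mulrA.
  exact: circle_L2_seriesZ.
- have -> : fb_normal kappa h x0 (fun m => c * a m) =
      fun m x => c * fb_normal kappa h x0 a m x.
    by apply/funext => m; apply/funext => x; rewrite /fb_normal mulrA.
  exact: circle_L2_seriesZ.
Qed.

Lemma cauchy_series_sum n (a : 'I_n -> int -> R[i]) (f g : 'I_n -> plane R -> R[i]) :
  (forall j, cauchy_series (a j) (f j) (g j)) ->
  cauchy_series (fun m => \sum_(j < n) a j m) (fun x => \sum_(j < n) f j x)
    (fun x => \sum_(j < n) g j x).
Proof.
move=> afg; split.
- have -> : fb_value kappa x0 (fun m => \sum_(j < n) a j m) =
      fun m x => \sum_(j < n) fb_value kappa x0 (a j) m x.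
    by apply/funext => m; apply/funext => x; rewrite /fb_value mulr_suml.
  by apply: (circle_L2_series_sum h_gt0) => j; case: (afg j).
- have -> : fb_normal kappa h x0 (fun m => \sum_(j < n) a j m) =
      fun m x => \sum_(j < n) fb_normal kappa h x0 (a j) m x.
    by apply/funext => m; apply/funext => x; rewrite /fb_normal mulr_suml.
  by apply: (circle_L2_series_sum h_gt0) => j; case: (afg j).
Qed.

Lemma isum_trunc (V : zmodType) M N (F : int -> V) : (M <= N)%N ->
  isum N (fun m => if (`|m| <= M)%N then F m else 0) = isum M F.
Proof.
elim: N => [|N IH]; first by rewrite leqn0 => /eqP ->; rewrite !isum0.
rewrite leq_eqVlt => /predU1P[->|MN]; first by apply: eq_isum => m ->.
by rewrite isumS IH// !ifF ?add0r ?addr0//; lia.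
Qed.

Lemma circle_L2_series_trunc M (F : int -> plane R -> R[i]) :
  (forall m, circle_measurable x0 h (F m)) ->
  circle_L2_series h x0 (fun m x => if (`|m| <= M)%N then F m x else 0)
    (fun x => isum M (F^~ x)).
Proof.
move=> mF; split.
  by move=> m; case: (leqP `|m|%N M) => _ //; exact: circle_measurable_cst.
split; first exact: circle_measurable_isum.
apply: cvg_near_cst; exists M => // N /= MN.
rewrite -[RHS](_ : circle_int x0 h (fun=> 0) = 0%E).
  apply: eq_circle_int => t; rewrite -/(isum _ _) -[symsum _ _]/(isum _ _).
  by rewrite isum_trunc// subrr normc0 expr0n.
by rewrite circle_int_cst mul0r mulr0.
Qed.

Lemma cauchy_series_trunc M (b : int -> R[i]) :
  cauchy_series (fun m => if (`|m| <= M)%N then b m else 0)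
    (fun x => isum M (fb_value kappa x0 b ^~ x))
    (fun x => isum M (fb_normal kappa h x0 b ^~ x)).
Proof.
split.
- have -> : fb_value kappa x0 (fun m => if (`|m| <= M)%N then b m else 0) =
      fun m x => if (`|m| <= M)%N then fb_value kappa x0 b m x else 0.
    by apply/funext => m; apply/funext => x; rewrite /fb_value; case: ifP => // _;
      rewrite mul0r.
  by apply: circle_L2_series_trunc => m; exact: fb_value_measurable.
- have -> : fb_normal kappa h x0 (fun m => if (`|m| <= M)%N then b m else 0) =
      fun m x => if (`|m| <= M)%N then fb_normal kappa h x0 b m x else 0.
    by apply/funext => m; apply/funext => x; rewrite /fb_normal; case: ifP => // _;
      rewrite mul0r.
  by apply: circle_L2_series_trunc => m; exact: fb_normal_measurable.
Qed.

Lemma is_cderive_plane_wave z t : is_cderive h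
  (fun rho => plane_wave kappa x0 z (circle_pt x0 rho t))
  (kappa%:C%C * (ja_exponent (wave_phase z t) *
    cexp (ja_exponent (wave_phase z t) * (kappa * h)%:C%C))).
Proof.
pose al := ja_exponent (wave_phase z t).
have -> : (fun rho => plane_wave kappa x0 z (circle_pt x0 rho t)) =
    fun rho => cexp (al * kappa%:C%C * rho%:C%C).
  by apply/funext => rho; rewrite plane_wave_circle rmorphM mulrA.
apply: is_cderive_eq (is_cderive_cexp h (al * kappa%:C%C)) _.
rewrite -/al.
have -> : al * (kappa * h)%:C%C = al * kappa%:C%C * h%:C%C by rewrite rmorphM mulrA.
by ring.
Qed.

Lemma normal_derive_plane_wave z t :
  normal_derive x0 h (plane_wave kappa x0 z) (circle_pt x0 h t) =
  kappa%:C%C * (ja_exponent (wave_phase z t) *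
    cexp (ja_exponent (wave_phase z t) * (kappa * h)%:C%C)).
Proof. exact/(normal_derive_radial h_gt0)/is_cderive_plane_wave. Qed.

(** The Fourier-Bessel coefficients of the plane wave of angle z. *)
Definition wave_coeff (z : R[i]) (m : int) : R[i] :=
  'i%C ^ m * cexp (- ('i%C * m%:~R * z)).

Lemma wave_coeffE z m t :
  wave_coeff z m * cis t ^ m = ('i%C * wave_phase z t) ^ m.
Proof.
have wE : cexp (- ('i%C * m%:~R * z)) = cexp (- ('i%C * z)) ^ m.
  by rewrite -cexp_mulz; congr cexp; ring.
rewrite /wave_coeff /wave_phase wE; move: (cexp _) => w.
have -> : ('i%C * (cis t * w)) ^ m = 'i%C ^ m * (cis t * w) ^ m by exact: expfzMl.
have -> : (cis t * w) ^ m = cis t ^ m * w ^ m by exact: expfzMl.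
by rewrite -mulrA (mulrC (w ^ m)).
Qed.

Lemma is_cderive_wave_exponent z (t : R) : exists d,
  is_cderive t (fun t : R => ja_exponent (wave_phase z t)) d.
Proof.
pose w := cexp (- ('i%C * z)).
have -> : (fun t : R => ja_exponent (wave_phase z t)) =
    fun t : R => 'i%C / 2 * (w * cexp ('i%C * t%:C%C)) + 'i%C / 2 * (w^-1 * cexp (- 'i%C * t%:C%C)).
  apply/funext => s; rewrite /ja_exponent /wave_phase [cis s]cis_cexp -/w invfM.
  by rewrite mulNr cexpN; ring.
by eexists; apply: is_cderiveD; do 2 apply: is_cderiveZ; exact: is_cderive_cexp.
Qed.

(** On the circle the partial sums of the two series are the sums of the Jacobi-Anger
expansion and of its derivative, which converge uniformly in t. *)
Lemma cauchy_series_plane_wave z :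
  cauchy_series (wave_coeff z) (plane_wave kappa x0 z)
    (normal_derive x0 h (plane_wave kappa x0 z)).
Proof.
have kh0 : 0 <= kappa * h by rewrite mulr_ge0 ?ltW.
pose r := expR `|complex.Im z|.
have zr t : normc (wave_phase z t) <= r.
  by rewrite normc_wave_phase ler_expR ler_norm.
have zVr t : (normc (wave_phase z t))^-1 <= r.
  by rewrite normc_wave_phase -expRN ler_expR -normrN ler_norm.
have value_sum N t : isum N (fb_value kappa x0 (wave_coeff z) ^~ (circle_pt x0 h t)) =
    ja_sum N (wave_phase z t) (kappa * h).
  apply: eq_isum => m _; rewrite fb_value_circle// -wave_coeffE; ring.
have normal_sum N t :
    isum N (fb_normal kappa h x0 (wave_coeff z) ^~ (circle_pt x0 h t)) =
    kappa%:C%C * ja_dsum N (wave_phase z t) (kappa * h).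
  rewrite -isumZ; apply: eq_isum => m _.
  by rewrite fb_normal_circle// -wave_coeffE derive1_besselJ rmorphM/=; ring.
have err0 (C : R) : (fun N => C * ja_error r (kappa * h) N) @ \oo --> (0 : R).
  by have := cvgMl_tmp (a := C) (@cvg_ja_error R r (kappa * h)); rewrite mulr0; apply.
have dphase t : exists d, is_cderive t (fun t : R =>
    cexp ((kappa * h)%:C%C * ja_exponent (wave_phase z t))) d.
  have [d dE] := is_cderive_wave_exponent z t.
  by eexists; apply: is_cderive_cexp_comp; apply: is_cderiveZ; exact: dE.
split.
- apply: (circle_L2_series_uniform h_gt0 _ _ _
    (err0 (2 * expR (r * (kappa * h)) ^+ 2 * (kappa * h)))).
  + by move=> m; exact: fb_value_measurable.
  + apply: circle_measurable_cderive => t; have [d dE] := dphase t; exists d.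
    by under eq_fun do rewrite plane_wave_circle mulrC.
  + move=> N t; rewrite value_sum plane_wave_circle -normcN opprB.
    exact: jacobi_anger (wave_phase_neq0 _ _) (zr t) (zVr t) _ _ kh0.
- apply: (circle_L2_series_uniform h_gt0 _ _ _
    (err0 (kappa * (2 * expR (r * (kappa * h)) ^+ 2 * (kappa * h) * r + 1)))).
  + by move=> m; exact: fb_normal_measurable.
  + apply: circle_measurable_cderive => t; have [d dE] := dphase t.
    have [e eE] := is_cderive_wave_exponent z t; eexists.
    under eq_fun do rewrite normal_derive_plane_wave [_ * (kappa * h)%:C%C]mulrC.
    by apply: is_cderiveZ; apply: is_cderiveM; [exact: eE|exact: dE].
  + move=> N t; rewrite normal_sum normal_derive_plane_wave -mulrBr normcM normc_real.
    rewrite gtr0_norm// -mulrA ler_wpM2l ?(ltW kappa_gt0)// -normcN opprB.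
    exact: jacobi_anger_derive (wave_phase_neq0 _ _) (zr t) (zVr t) _ _ kh0.
Qed.

End CauchySeries.


(** * Minima of quadratic functions *)

Lemma cvg_ord_sum (R : realType) n (f : 'I_n -> nat -> R) (l : 'I_n -> R) :
  (forall i, f i @ \oo --> l i) ->
  (fun N => \sum_(i < n) f i N) @ \oo --> \sum_(i < n) l i.
Proof.
move=> fl; by apply: cvg_big => //; exact: add_continuous.
Qed.

Section QuadraticFunctions.
Variables (R : realType) (n : nat).
Implicit Types (Q : 'rV[R]_n -> R) (s t : 'rV[R]_n).

Let e (k : 'I_n) : 'rV[R]_n := delta_mx 0 k.

Definition quad_mx Q : 'M[R]_n :=
  \matrix_(k, l) ((Q (e k + e l) - Q (e k) - Q (e l) + Q 0) / 2).

Definition quad_row Q : 'rV[R]_n := \row_k ((Q (- e k) - Q (e k)) / 4).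

(** The polynomials of degree at most two. Their coefficients are read off from finitely
many values of Q, so that the condition is a linear identity between values of Q and
passes to pointwise limits. *)
Definition quadratic Q := forall s, Q s =
  \sum_k \sum_l s 0 k * s 0 l * quad_mx Q k l
  - 2 * (\sum_k s 0 k * quad_row Q 0 k) + Q 0.

Lemma quad_mxC Q k l : quad_mx Q k l = quad_mx Q l k.
Proof. by rewrite !mxE [e k + e l]addrC; congr (_ / 2); ring. Qed.

Lemma quadratic_sqr (g : R) (x : 'I_n -> R) :
  quadratic (fun s => (g - \sum_k s 0 k * x k) ^+ 2).
Proof.
pose L s := \sum_k s 0 k * x k.
have LD s t : L (s + t) = L s + L t.
  by rewrite /L -big_split; apply: eq_bigr => k _; rewrite mxE mulrDl.
have Le k : L (e k) = x k.
  rewrite /L (bigD1 k)//= big1 ?addr0 => [|l lk]; rewrite !mxE !eqxx/=.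
    by rewrite mul1r.
  by rewrite (negbTE lk) mul0r.
have L0 : L 0 = 0 by rewrite /L big1// => k _; rewrite mxE mul0r.
have LN s : L (- s) = - L s.
  by rewrite /L -sumrN; apply: eq_bigr => k _; rewrite mxE mulNr.
move=> s; rewrite -!/(L _) L0.
have -> : \sum_k \sum_l s 0 k * s 0 l * quad_mx (fun s => (g - L s) ^+ 2) k l = L s * L s.
  rewrite {2}/L mulr_suml; apply: eq_bigr => k _.
  rewrite /L mulr_sumr; apply: eq_bigr => l _.
  by rewrite mxE /= -!/(L _) LD !Le L0; field.
have -> : \sum_k s 0 k * quad_row (fun s => (g - L s) ^+ 2) 0 k = g * L s.
  rewrite /L mulr_sumr; apply: eq_bigr => k _.
  by rewrite mxE /= -!/(L _) LN Le; field.
by ring.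
Qed.

Lemma quadraticD Q1 Q2 : quadratic Q1 -> quadratic Q2 ->
  quadratic (fun s => Q1 s + Q2 s).
Proof.
move=> q1 q2 s; rewrite q1 q2.
have -> : \sum_k \sum_l s 0 k * s 0 l * quad_mx (fun s => Q1 s + Q2 s) k l =
    \sum_k \sum_l s 0 k * s 0 l * quad_mx Q1 k l +
    \sum_k \sum_l s 0 k * s 0 l * quad_mx Q2 k l.
  rewrite -big_split; apply: eq_bigr => k _; rewrite -big_split.
  by apply: eq_bigr => l _; rewrite !mxE /=; field.
have -> : \sum_k s 0 k * quad_row (fun s => Q1 s + Q2 s) 0 k =
    \sum_k s 0 k * quad_row Q1 0 k + \sum_k s 0 k * quad_row Q2 0 k.
  by rewrite -big_split; apply: eq_bigr => k _; rewrite !mxE /=; field.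
by ring.
Qed.

Lemma quadraticZ (c : R) Q : quadratic Q -> quadratic (fun s => c * Q s).
Proof.
move=> q s; rewrite q.
have -> : \sum_k \sum_l s 0 k * s 0 l * quad_mx (fun s => c * Q s) k l =
    c * \sum_k \sum_l s 0 k * s 0 l * quad_mx Q k l.
  rewrite mulr_sumr; apply: eq_bigr => k _; rewrite mulr_sumr.
  by apply: eq_bigr => l _; rewrite !mxE /=; field.
have -> : \sum_k s 0 k * quad_row (fun s => c * Q s) 0 k =
    c * \sum_k s 0 k * quad_row Q 0 k.
  by rewrite mulr_sumr; apply: eq_bigr => k _; rewrite !mxE /=; field.
by ring.
Qed.

Lemma quadratic_sum (I : Type) (r : seq I) (F : I -> 'rV[R]_n -> R) :
  (forall i, quadratic (F i)) -> quadratic (fun s => \sum_(i <- r) F i s).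
Proof.
move=> qF; elim: r => [|i r IH].
  have -> : (fun s => \sum_(i <- [::]) F i s) =
      fun s => (0 - \sum_k s 0 k * (fun=> 0) k) ^+ 2.
    apply/funext => s; rewrite big_nil big1 => [|k _]; last by rewrite mulr0.
    by rewrite subrr expr0n.
  exact: quadratic_sqr.
have -> : (fun s => \sum_(j <- i :: r) F j s) = fun s => F i s + \sum_(j <- r) F j s.
  by apply/funext => s; rewrite big_cons.
exact: quadraticD.
Qed.

Lemma quadratic_lim (QN : nat -> 'rV[R]_n -> R) Q : (forall N, quadratic (QN N)) ->
  (forall s, (fun N => QN N s) @ \oo --> Q s) -> quadratic Q.
Proof.
move=> qN QQ s.
have cmx k l : (fun N => quad_mx (QN N) k l) @ \oo --> quad_mx Q k l.
  rewrite mxE; under eq_fun do rewrite mxE.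
  by apply: cvgMr_tmp; apply: cvgD => //; apply: cvgB => //; apply: cvgB.
have crow k : (fun N => quad_row (QN N) 0 k) @ \oo --> quad_row Q 0 k.
  rewrite mxE; under eq_fun do rewrite mxE.
  by apply: cvgMr_tmp; apply: cvgB.
have h1 : (fun N => \sum_k \sum_l s 0 k * s 0 l * quad_mx (QN N) k l
  - 2 * (\sum_k s 0 k * quad_row (QN N) 0 k) + QN N 0) @ \oo -->
  (\sum_k \sum_l s 0 k * s 0 l * quad_mx Q k l
  - 2 * (\sum_k s 0 k * quad_row Q 0 k) + Q 0).
  apply: cvgD; last exact: QQ.
  apply: cvgB; last apply: cvgMl_tmp.
    apply: cvg_ord_sum => k; apply: cvg_ord_sum => l; exact: cvgMl_tmp.
  by apply: cvg_ord_sum => k; exact: cvgMl_tmp.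
have E : (fun N => QN N s) = fun N => \sum_k \sum_l s 0 k * s 0 l * quad_mx (QN N) k l
    - 2 * (\sum_k s 0 k * quad_row (QN N) 0 k) + QN N 0.
  by apply/funext => N; exact: qN.
by rewrite -(cvg_lim _ (QQ s))// E; exact: cvg_lim h1.
Qed.

(** A nonnegative quadratic function attains its minimum, even if it is degenerate: its linear
part vanishes on the kernel of its matrix, because a nonconstant affine function on a line
is unbounded below; so the equation for a critical point is solvable. *)
Lemma quadratic_min Q : quadratic Q -> (forall s, 0 <= Q s) ->
  exists s0, forall s, Q s0 <= Q s.
Proof.
move=> qQ Q0; set A := quad_mx Q; set b := quad_row Q.
pose B s t : R := (s *m A *m t^T) 0 0.
pose L t : R := (b *m t^T) 0 0.
have AT : A^T = A by apply/matrixP => k l; rewrite mxE quad_mxC.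
have QE s : Q s = B s s - 2 * L s + Q 0.
  rewrite qQ; congr (_ - 2 * _ + _).
    rewrite /B mxE exchange_big; apply: eq_bigr => l _.
    by rewrite !mxE mulr_suml; apply: eq_bigr => k _; rewrite mulrAC.
  by rewrite /L mxE; apply: eq_bigr => k _; rewrite !mxE mulrC.
have BDl s t u : B (s + t) u = B s u + B t u by rewrite /B !mulmxDl mxE.
have BDr s t u : B u (s + t) = B u s + B u t by rewrite /B linearD mulmxDr mxE.
have BZl (c : R) s t : B (c *: s) t = c * B s t by rewrite /B -!scalemxAl mxE.
have BZr (c : R) s t : B s (c *: t) = c * B s t.
  by rewrite /B linearZ -scalemxAr mxE.
have LZ (c : R) t : L (c *: t) = c * L t by rewrite /L linearZ -scalemxAr mxE.
have BC s t : B s t = B t s.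
  have -> : B s t = ((s *m A *m t^T)^T) 0 0 by rewrite [RHS]mxE.
  by rewrite !trmx_mul trmxK AT mulmxA.
have QZ (c : R) t : Q (c *: t) = c * (c * B t t) - 2 * (c * L t) + Q 0.
  by rewrite QE BZl BZr LZ.
have B0 t : 0 <= B t t.
  rewrite leNgt; apply/negP => Bt0.
  (* Then Q (c t) + Q (- c t) = 2 (c^2 B t t + Q 0), and c is at least 1 and satisfies
     c B t t = B t t - Q 0, so this sum is negative. *)
  pose c := 1 - Q 0 / B t t.
  have c1 : 1 <= c by rewrite /c lerDl oppr_ge0 mulr_ge0_le0// invr_le0 ltW.
  have := addr_ge0 (Q0 (c *: t)) (Q0 (- c *: t)).
  rewrite !QZ.
  have cB : c * B t t = B t t - Q 0 by rewrite /c mulrBl mul1r divfK ?lt_eqF.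
  have cQ : 0 <= c * Q 0 by rewrite mulr_ge0// (le_trans ler01).
  rewrite (_ : _ + _ = 2 * (c * (c * B t t) + Q 0)); last by ring.
  rewrite cB mulrBr cB => H.
  have : 2 * (B t t - c * Q 0) < 0.
    by rewrite pmulr_rlt0// subr_lt0 (lt_le_trans Bt0).
  by rewrite ltNge => /negP; apply; move: H; rewrite addrAC subrK.
have bA : (b <= A)%MS.
  rewrite submxE; apply/eqP/matrixP => i j; rewrite ord1 [RHS]mxE.
  pose t := (col j (cokermx A))^T.
  have At s : B s t = 0.
    by rewrite /B trmxK colE -mulmxA (mulmxA A) mulmx_coker mul0mx mulmx0 mxE.
  have Lt : L t = (b *m cokermx A) 0 j by rewrite /L trmxK colE mulmxA -colE mxE.
  rewrite -Lt; apply/eqP; rewrite -[_ == _]negbK; apply/negP => Lt0.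
  (* On the line through the kernel vector t, Q is affine; here its value is -1. *)
  have := Q0 (((Q 0 + 1) / (2 * L t)) *: t).
  rewrite QZ At !mulr0 sub0r leNgt => /negP; apply.
  have -> : 2 * ((Q 0 + 1) / (2 * L t) * L t) = Q 0 + 1 by field.
  by rewrite opprD addrAC addNr sub0r ltrN10.
have [s0 bE] := submxP bA; exists s0 => s.
have LE t : L t = B s0 t by rewrite /L bE.
have := B0 (s - s0); rewrite [Q s0]QE [Q s]QE !LE.
have -> : B (s - s0) (s - s0) = B s s - 2 * B s0 s + B s0 s0.
  by rewrite -scaleN1r BDl !BDr BZr !BZl BZr (BC s s0); ring.
by move=> H; rewrite -subr_ge0; apply: le_trans H _; rewrite le_eqVlt; apply/orP;
  left; apply/eqP; ring.
Qed.

End QuadraticFunctions.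


(** * The least squares problem for the coefficients *)

Section LeastSquares.
Variables (R : realType) (n : nat).
Variables (w : int -> R) (gamma : int -> R[i]) (p : 'I_n -> int -> R[i]).

(** The weighted residual with the condition |m| > M absorbed into the weights. *)
Definition residual (c : 'I_n -> R[i]) : \bar R :=
  (\esum_(m in [set: int])
    (w m * normc (gamma m - \sum_(j < n) c j * p j m) ^+ 2)%:E)%E.

Definition complex_coords (s : 'rV[R]_(n + n)) (j : 'I_n) : R[i] :=
  (s 0 (lshift n j) +i* s 0 (rshift n j))%C.

Lemma complex_coords_surj c : exists s, c = complex_coords s.
Proof.
exists (row_mx (\row_j complex.Re (c j)) (\row_j complex.Im (c j))).
apply/funext => j; rewrite /complex_coords row_mxEl row_mxEr !mxE.
by case: (c j).
Qed.

Lemma quadratic_residual_term m : quadratic (fun s : 'rV[R]_(n + n) =>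
  normc (gamma m - \sum_(j < n) complex_coords s j * p j m) ^+ 2).
Proof.
pose x := row_mx (\row_j complex.Re (p j m)) (\row_j - complex.Im (p j m)).
pose y := row_mx (\row_j complex.Im (p j m)) (\row_j complex.Re (p j m)).
have Re_sum (F : 'I_n -> R[i]) : complex.Re (\sum_j F j) = \sum_j complex.Re (F j).
  by apply: (big_morph _ (@complex_ReD R)).
have Im_sum (F : 'I_n -> R[i]) : complex.Im (\sum_j F j) = \sum_j complex.Im (F j).
  by apply: (big_morph _ (@complex_ImD R)).
rewrite (_ : (fun s => _) = fun s : 'rV[R]_(n + n) =>
    (complex.Re (gamma m) - \sum_k s 0 k * x 0 k) ^+ 2 +
    (complex.Im (gamma m) - \sum_k s 0 k * y 0 k) ^+ 2).
  by apply: quadraticD; exact: quadratic_sqr.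
apply/funext => s; rewrite normc2E !complexpE Re_sum Im_sum.
have xE : \sum_j complex.Re (complex_coords s j * p j m) = \sum_k s 0 k * x 0 k.
  rewrite big_split_ord/= -[RHS]/(_ + _) -big_split; apply: eq_bigr => j _.
  by rewrite complexpE /x row_mxEl row_mxEr !mxE/= mulrN.
have yE : \sum_j complex.Im (complex_coords s j * p j m) = \sum_k s 0 k * y 0 k.
  rewrite big_split_ord/= -[RHS]/(_ + _) -big_split; apply: eq_bigr => j _.
  by rewrite complexpE /y row_mxEl row_mxEr !mxE.
by rewrite xE yE.
Qed.

(** The residual is the limit of its partial sums, hence a nonnegative quadratic function of
the real and imaginary parts of the coefficients. *)
Lemma residual_min : (forall m, 0 <= w m) -> (forall c, (residual c < +oo)%E) ->
  exists c0, forall c, (residual c0 <= residual c)%E.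
Proof.
move=> w0 fin.
have term0 c m : 0 <= w m * normc (gamma m - \sum_(j < n) c j * p j m) ^+ 2.
  by rewrite mulr_ge0 ?sqr_ge0.
have res0 c : (0 <= residual c)%E by apply: esum_ge0 => m _; rewrite lee_fin.
pose Q (s : 'rV[R]_(n + n)) : R := fine (residual (complex_coords s)).
have QE s : (Q s)%:E = residual (complex_coords s).
  by rewrite fineK// ge0_fin_numE.
pose QN N (s : 'rV[R]_(n + n)) : R := isum N (fun m =>
  w m * normc (gamma m - \sum_(j < n) complex_coords s j * p j m) ^+ 2).
have qQ : quadratic Q.
  apply: (@quadratic_lim _ _ QN) => [N|s].
    apply: quadratic_sum => k; apply: quadraticZ; exact: quadratic_residual_term.
  have := @cvg_isum_esum R (fun m =>
    w m * normc (gamma m - \sum_(j < n) complex_coords s j * p j m) ^+ 2) (term0 _).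
  by rewrite -/(residual _) -QE => /fine_cvg.
have [|s0 s0min] := quadratic_min qQ; first by move=> s; exact: fine_ge0.
exists (complex_coords s0) => c; have [s ->] := complex_coords_surj c.
by rewrite -!QE lee_fin.
Qed.

End LeastSquares.

(** * Best approximation in the trace norm *)

Section BestApproximation.
Variables (R : realType) (kappa h : R) (x0 : plane R) (q M : nat).
Variable z : 'I_q -> R[i].
Hypotheses (kappa_gt0 : 0 < kappa) (h_gt0 : 0 < h).
Variables (a : int -> R[i]) (fu gu : plane R -> R[i]).
Hypothesis u_trace : cauchy_data kappa x0 h a fu gu.

Let gamma m : R[i] := 'i%C ^ (- m) * a m.

Definition trial (c : 'I_q -> R[i]) (b : int -> R[i]) (x : plane R) : R[i] :=
  \sum_(j < q) c j * plane_wave kappa x0 (z j) x +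
  symsum M (fun m => b m * fourier_bessel kappa x0 m x).

Definition trial_coeff (c : 'I_q -> R[i]) (b : int -> R[i]) (m : int) : R[i] :=
  \sum_(j < q) c j * wave_coeff (z j) m + (if (`|m| <= M)%N then b m else 0).

Let trace_error c b := trace_norm2 kappa x0 h (fun x => fu x - trial c b x)
  (fun x => gu x - normal_derive x0 h (trial c b) x).

Lemma normal_derive_trial c b t :
  normal_derive x0 h (trial c b) (circle_pt x0 h t) =
  \sum_(j < q) c j * normal_derive x0 h (plane_wave kappa x0 (z j)) (circle_pt x0 h t)
  + isum M (fb_normal kappa h x0 b ^~ (circle_pt x0 h t)).
Proof.
apply: (normal_derive_radial h_gt0).
have d1 : is_cderive h (fun rho =>
    \sum_(j < q) c j * plane_wave kappa x0 (z j) (circle_pt x0 rho t))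
    (\sum_(j < q) c j * normal_derive x0 h (plane_wave kappa x0 (z j)) (circle_pt x0 h t)).
  apply: is_cderive_sum => j; apply: is_cderiveZ.
  by rewrite (normal_derive_plane_wave _ _ h_gt0); exact: is_cderive_plane_wave.
have d2 : is_cderive h (fun rho =>
    isum M (fun m => b m * fourier_bessel kappa x0 m (circle_pt x0 rho t)))
    (isum M (fb_normal kappa h x0 b ^~ (circle_pt x0 h t))).
  apply: is_cderive_isum => m; apply: is_cderiveZ.
  by rewrite normal_derive_fourier_bessel//; exact: is_cderive_fourier_bessel.
exact: is_cderiveD d1 d2.
Qed.

Lemma trace_error_series c b :
  trace_error c b = (\esum_(m in [set: int])
    (normc (a m - trial_coeff c b m) ^+ 2 * tau kappa h m ^+ 2)%:E)%E /\
  (trace_error c b < +oo)%E.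
Proof.
pose g x := \sum_(j < q) c j * normal_derive x0 h (plane_wave kappa x0 (z j)) x
  + isum M (fb_normal kappa h x0 b ^~ x).
have trialP : cauchy_series kappa h x0 (trial_coeff c b) (trial c b) g.
  have waves := cauchy_series_sum h_gt0 (fun j => cauchy_seriesZ (c j)
    (cauchy_series_plane_wave x0 kappa_gt0 h_gt0 (z j))).
  have low := cauchy_series_trunc x0 kappa_gt0 h_gt0 M b.
  have both := cauchy_seriesD h_gt0 waves low.
  exact: both.
have uP : cauchy_series kappa h x0 a fu gu by exact/cauchy_seriesP.
have := cauchy_seriesD h_gt0 uP (cauchy_seriesZ (-1) trialP).
move=> /(trace_norm2_parseval kappa_gt0 h_gt0).
have -> : trace_norm2 kappa x0 h (fun x => fu x + -1 * trial c b x)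
    (fun x => gu x + -1 * g x) = trace_error c b.
  by apply: eq_circle_int => t; rewrite !mulN1r normal_derive_trial.
by under eq_esum do rewrite mulN1r.
Qed.

Let weight (m : int) : R := if (M < `|m|)%N then tau kappa h m ^+ 2 else 0.

Lemma weighted_residualE c : weighted_residual kappa h M z gamma c =
  residual weight gamma (fun j m => cexp (- ('i%C * m%:~R * z j))) c.
Proof.
rewrite /weighted_residual esum_mkcond; apply: eq_esum => m _.
rewrite /weight; case: ltnP => Mm; first by rewrite mem_set.
by rewrite memNset ?mul0r//=; apply/negP; rewrite -leqNgt.
Qed.

Lemma residual_termE c b m : (M < `|m|)%N ->
  normc (a m - trial_coeff c b m) =
  normc (gamma m - \sum_(j < q) c j * cexp (- ('i%C * m%:~R * z j))).
Proof.
move=> Mm; have iu : ('i%C : R[i]) \is a GRing.unit by exact: complex_i_unit.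
have -> : a m - trial_coeff c b m =
    'i%C ^ m * (gamma m - \sum_(j < q) c j * cexp (- ('i%C * m%:~R * z j))).
  rewrite mulrBr /gamma mulrA -exprzDr// subrr expr0z mul1r /trial_coeff leqNgt Mm/= addr0.
  by congr (_ - _); rewrite mulr_sumr; apply: eq_bigr => j _; rewrite /wave_coeff mulrCA.
by rewrite normcM normc_exprz normc_i exp1rz mul1r.
Qed.

Lemma weighted_residual_le c b :
  (weighted_residual kappa h M z gamma c <= trace_error c b)%E.
Proof.
rewrite weighted_residualE (trace_error_series c b).1; apply: le_esum => m _.
rewrite lee_fin /weight; case: ltnP => Mm; last by rewrite mul0r mulr_ge0 ?sqr_ge0.
by rewrite residual_termE// mulrC.
Qed.

(** The Fourier-Bessel part of the trial space can cancel all modes with |m| <= M of the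
error, and it does not affect the others. *)
Lemma weighted_residual_attained c :
  exists b, trace_error c b = weighted_residual kappa h M z gamma c.
Proof.
exists (fun m => a m - \sum_(j < q) c j * wave_coeff (z j) m).
rewrite weighted_residualE (trace_error_series c _).1; apply: eq_esum => m _.
rewrite /weight; case: ltnP => Mm; first by rewrite residual_termE// mulrC.
by rewrite /trial_coeff Mm addrCA subrr addr0 subrr normc0 expr0n/= !mul0r.
Qed.

End BestApproximation.

Theorem theorem3p5 (R : realType) (kappa h : R) (x0 : plane R) (q M : nat)
    (z : 'I_q -> R[i]) (eta_max : R)
    (u : plane R -> R[i]) (a : int -> R[i]) (fu gu : plane R -> R[i])
    (kappa_gt0 : 0 < kappa) (h_gt0 : 0 < h) (q_ge1 : (1 <= q)%N)
    (z_bound : forall j, `|complex.Im (z j)| <= eta_max)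
    (u_helmholtz : helmholtz_field kappa (disc x0 h) u)
    (u_expansion : fourier_bessel_expansion kappa x0 (disc x0 h) u a)
    (u_finite : finite_trace_norm kappa h a)
    (u_trace : cauchy_data kappa x0 h a fu gu) :
  let gamma := fun m : int => 'i%C ^ (- m) * a m in
  exists c0 : 'I_q -> R[i],
    (forall c : 'I_q -> R[i],
       (weighted_residual kappa h M z gamma c0
          <= weighted_residual kappa h M z gamma c)%E) /\
    ereal_inf [set trace_norm2 kappa x0 h
                     (fun x => fu x - v x)
                     (fun x => gu x - normal_derive x0 h v x)
              | v in trial_space kappa x0 M z] =
    weighted_residual kappa h M z gamma c0.
Proof.
move=> gamma.
have [|c|c0 c0min] := @residual_min R q
    (fun m => if (M < `|m|)%N then tau kappa h m ^+ 2 else 0) gamma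
    (fun j m => cexp (- ('i%C * m%:~R * z j))).
- by move=> m; case: ifP => // _; exact: sqr_ge0.
- rewrite -weighted_residualE.
  have [b <-] := weighted_residual_attained M z kappa_gt0 h_gt0 u_trace c.
  by case: (trace_error_series M z kappa_gt0 h_gt0 u_trace c b).
have {}c0min c : (weighted_residual kappa h M z gamma c0 <=
    weighted_residual kappa h M z gamma c)%E.
  by rewrite !weighted_residualE; exact: c0min.
exists c0; split => //; apply/eqP; rewrite eq_le; apply/andP; split.
- have [b bE] := weighted_residual_attained M z kappa_gt0 h_gt0 u_trace c0.
  rewrite -bE; apply: ereal_inf_lbound.
  by exists (trial kappa x0 M z c0 b) => //; exists c0, b.
- apply: le_ereal_inf_tmp => _ [_ [c [b ->]] <-].
  apply: le_trans (c0min c) _.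
  exact: (weighted_residual_le M z kappa_gt0 h_gt0 u_trace c b).
Qed.
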